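(* Let $(\Lambda V,d)$ be a pure elliptic minimal Sullivan model where $d$ is a differential of constant length. Then there exists an $F_0$-basis extension $$(\Lambda Z,d)\hookrightarrow(\Lambda V,d)$$ where $Z^{even}=V^{even}$.
   Context: All algebras and vector spaces are over $\mathbb{Q}$. $\Lambda V$ denotes the free graded-commutative algebra on the graded vector space $V$, and $\Lambda^kV$ the span of words of length $k$. All models $(\Lambda V,d)$ are minimal Sullivan models of simply-connected spaces of finite type, so $V=V^{\geq 2}$. The model $(\Lambda V,d)$ is minimal if $dV\subset\Lambda^{\geq 2}V$; pure if $dV^{even}=0$ and $dV^{odd}\subset\Lambda V^{even}$; elliptic if $\dim V<\infty$ and $\dim H^*(\Lambda V,d)<\infty$. The differential $d$ is of constant length if there is an integer $l\geq 2$ (the length) with $dV\subset\Lambda^lV$. The homotopy characteristic is $\chi_{\pi}(\Lambda V)=\dim V^{even}-\dim V^{odd}$. A pure elliptic model $(\Lambda Z,d)$ is an $F_0$-model if $\chi_{\pi}(\Lambda Z)=0$, i.e. $\dim Z^{even}=\dim Z^{odd}$. Given a pure elliptic model $(\Lambda V,d)$, an $F_0$-basis extension is a relative Sullivan model given by the inclusion $(\Lambda Z,d)\hookrightarrow(\Lambda V,d)$, where $Z$ is a graded subspace of $V$ (so in particular $dZ\subset\Lambda Z$) and the pure model $(\Lambda Z,d)$ is an $F_0$-model. *)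

(* Defs.v *)
From HB Require Import structures.
From mathcomp Require Import all_boot all_order all_algebra.

Set Implicit Arguments.
Unset Strict Implicit.
Unset Printing Implicit Defensive.

Import GRing.Theory.
Local Open Scope ring_scope.

(* [G k a] : the element [a] is homogeneous of degree [k].  Since 2 is
   invertible, [gca_comm] already forces odd elements to square to zero. *)
Record graded_comm_algebra (A : algType rat) (G : nat -> A -> Prop) : Prop := {
  gca_zero : forall k, G k 0;
  gca_lin : forall k (c : rat) a b, G k a -> G k b -> G k (c *: a + b);
  gca_one : G 0%N 1;
  gca_mul : forall p q a b, G p a -> G q b -> G (p + q)%N (a * b);
  gca_span : forall a, exists (N : nat) (c : nat -> A),
    (forall k, G k (c k)) /\ a = \sum_(k < N) c k;
  gca_direct : forall (N : nat) (c : nat -> A),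
    (forall k, G k (c k)) -> \sum_(k < N) c k = 0 ->
    forall k, (k < N)%N -> c k = 0;
  gca_comm : forall p q a b, G p a -> G q b ->
    a * b = (-1 : rat) ^+ (p * q) *: (b * a)
}.

(* Graded vector spaces of finite type are families [V : nat -> vectType rat];
   the algebra Lambda V is specified by its universal property. *)
Definition free_gca (V : nat -> vectType rat) (A : algType rat)
    (G : nat -> A -> Prop) (iota : forall k, {linear V k -> A}) : Prop :=
  [/\ graded_comm_algebra G,
      forall k v, G k (iota k v)
    & forall (B : algType rat) (GB : nat -> B -> Prop)
        (phi : forall k, {linear V k -> B}),
        graded_comm_algebra GB -> (forall k v, GB k (phi k v)) ->
        exists f : {lrmorphism A -> B},
          [/\ forall k a, G k a -> GB k (f a),
              forall k v, f (iota k v) = phi k v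
            & forall g : {lrmorphism A -> B},
                (forall k a, G k a -> GB k (g a)) ->
                (forall k v, g (iota k v) = phi k v) -> g =1 f]].

(* A commutative differential graded algebra of the form (Lambda V, d). *)
Record freeCDGA := FreeCDGA {
  gens : nat -> vectType rat;
  alg : algType rat;
  homog : nat -> alg -> Prop;
  incl : forall k, {linear gens k -> alg};
  diff : {linear alg -> alg};
  free_alg : free_gca homog incl;
  diff_deg : forall k a, homog k a -> homog k.+1 (diff a);
  diff_leibniz : forall p a b, homog p a ->
    diff (a * b) = diff a * b + (-1 : rat) ^+ p *: (a * diff b);
  diff_diff : forall a, diff (diff a) = 0
}.

Definition graded_subspace (M : freeCDGA) := forall k, {vspace gens M k}.

Inductive lin_span (A : algType rat) (S : A -> Prop) : A -> Prop :=
| span_zero : lin_span S 0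
| span_lin (c : rat) (a b : A) : S a -> lin_span S b -> lin_span S (c *: a + b).

Section Models.
Variable M : freeCDGA.
Implicit Types Z Y W : graded_subspace M.
Local Notation d := (diff M).

Definition sub_full : graded_subspace M := fun k => fullv.
Definition sub_zero : graded_subspace M := fun k => 0%VS.
Definition sub_add Z Y : graded_subspace M := fun k => (Z k + Y k)%VS.
Definition sub_even Z : graded_subspace M :=
  fun k => if odd k then 0%VS else Z k.

Inductive word Z : nat -> alg M -> Prop :=
| word_nil : word Z 0 1
| word_cons k (v : gens M k) n a :
    v \in Z k -> word Z n a -> word Z n.+1 (incl M k v * a).

(* For a graded subspace Z of V, Lambda Z is identified with the subalgebra of
   Lambda V generated by Z (Lambda preserves injections over a field of
   characteristic 0). *)
Definition Lambda Z : alg M -> Prop := lin_span (fun a => exists n, word Z n a).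
Definition Lambda_pow Z l : alg M -> Prop := lin_span (word Z l).
Definition Lambda_ge Z l : alg M -> Prop :=
  lin_span (fun a => exists2 n, (l <= n)%N & word Z n a).

Definition d_maps Z (P : alg M -> Prop) : Prop :=
  forall k (v : gens M k), v \in Z k -> P (d (incl M k v)).

(* The inclusion (Lambda Z, d) -> (Lambda Y, d) is a relative Sullivan model:
   Y = Z (+) W with W the union of an increasing sequence F 0, F 1, ... such
   that d maps F 0 to Lambda Z and F (p + 1) to
   Lambda Z (x) Lambda (F p) = Lambda (Z (+) F p). *)
Definition relative_sullivan Z Y : Prop :=
  d_maps Z (Lambda Z) /\
  exists (W : graded_subspace M) (F : nat -> graded_subspace M),
    [/\ forall k, (Z k + W k)%VS = Y k /\ (Z k :&: W k)%VS = 0%VS,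
        forall p k, (F p k <= F p.+1 k)%VS /\ (F p k <= W k)%VS,
        forall k v, v \in W k -> exists p, v \in F p k,
        d_maps (F 0%N) (Lambda Z)
      & forall p, d_maps (F p.+1) (Lambda (sub_add Z (F p)))].

(* The case Z = 0; the requirement d (F 0) = 0 is d (F 0) in Lambda 0 = Q,
   since d (F 0) lies in positive degrees. *)
Definition sullivan Y : Prop := relative_sullivan sub_zero Y.

Definition minimal_sullivan Z : Prop :=
  [/\ Z 0%N = 0%VS, Z 1%N = 0%VS, sullivan Z & d_maps Z (Lambda_ge Z 2)].

Definition pure Z : Prop :=
  forall k (v : gens M k), v \in Z k ->
    if odd k then Lambda (sub_even Z) (d (incl M k v))
    else d (incl M k v) = 0.

(* Finitely many cocycles of Lambda Z span all cocycles modulo d (Lambda Z). *)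
Definition finite_dim_cohomology Z : Prop :=
  exists (n : nat) (h : 'I_n -> alg M),
    (forall i, Lambda Z (h i) /\ d (h i) = 0) /\
    forall a, Lambda Z a -> d a = 0 ->
      exists (c : 'I_n -> rat) (b : alg M),
        Lambda Z b /\ a = \sum_i c i *: h i + d b.

Definition vanishes_from Z (N : nat) : Prop :=
  forall k, (N <= k)%N -> Z k = 0%VS.

Definition elliptic Z : Prop :=
  (exists N, vanishes_from Z N) /\ finite_dim_cohomology Z.

Definition constant_length Z : Prop :=
  exists2 l, (2 <= l)%N & d_maps Z (Lambda_pow Z l).

(* chi_pi (Lambda Z) = c; defined for finite-dimensional Z only. *)
Definition has_homotopy_char Z (c : int) : Prop :=
  exists2 N, vanishes_from Z N &
    c = (\sum_(k < N | ~~ odd k) \dim (Z k))%N%:Z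
        - (\sum_(k < N | odd k) \dim (Z k))%N%:Z.

Definition F0_model Z : Prop :=
  [/\ minimal_sullivan Z, pure Z, elliptic Z & has_homotopy_char Z 0].

Definition F0_basis_extension Z : Prop :=
  relative_sullivan Z sub_full /\ F0_model Z.

End Models.

Arguments sub_full M : clear implicits.

(* Main.v *)
Require Import Defs.
From HB Require Import structures.
From mathcomp Require Import all_boot all_order all_algebra.
From mathcomp.multinomials Require mpoly.
From Stdlib Require Import Classical ClassicalEpsilon.

(* Let l be the length and a an even degree.  Killing all generators outside V^a turns d, restricted
   to V^(l a - 1), into a linear map to forms of degree l on V^a, and finiteness of the cohomology
   makes every variable nilpotent modulo these forms.  Over an infinite field dim V^a of the forms
   suffice: more forms are algebraically dependent, and a point where the dependency does not vanish
   gives a hyperplane of forms modulo which the remaining one is nilpotent; fewer forms are excluded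
   by counting monomials.  The corresponding generators, for all a, form Z^odd.  A word of length l
   and degree l a either has all its letters in V^a or has one of smaller degree, so by induction on
   a every even generator x has a power x^N = d b with b in Lambda Z.  The powers x^N are a regular
   sequence on Lambda Z acting trivially on cohomology, so H(Lambda Z) embeds into the cohomology of
   the quotient of Lambda Z by all x^N, which is finite-dimensional. *)

Set Implicit Arguments.
Unset Strict Implicit.
Unset Printing Implicit Defensive.

Import GRing.Theory.
Local Open Scope ring_scope.

(** Constant length is what makes the choice of odd generators compatible with the grading. If the
    differential of a generator of degree k restricts to a nonzero form on V^a, then k + 1 = l a. So
    all forms on V^a have the same degree l and come from the single space V^k, and a generic linear
    combination of them is again the restricted differential of one homogeneous generator. Forms of
    unequal degrees would come from different V^k, and combining them would leave the graded
    setting. Moreover a -> l a - 1 is injective, so different a draw on different odd degrees, and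
    the dimensions balance degree by degree.

    Passing from the differentials to powers of even basis letters makes regularity elementary: a
    power of a variable is cancelled by an explicit division operator. The price is a primitive of
    odd degree for each such power. *)

Section LinSpan.
Variable A : algType rat.
Implicit Types (S P : A -> Prop) (a b : A).

Definition lin_closed P := P 0 /\ forall (c : rat) a b, P a -> P b -> P (c *: a + b).

Lemma lin_closedD P a b : lin_closed P -> P a -> P b -> P (a + b).
Proof. by move=> [_ h] ha hb; rewrite -[a]scale1r; apply: h. Qed.

Lemma lin_closedZ P (c : rat) a : lin_closed P -> P a -> P (c *: a).
Proof. by move=> [h0 h] ha; rewrite -[c *: a]addr0; apply: h. Qed.

Lemma lin_closedN P a : lin_closed P -> P a -> P (- a).
Proof. by move=> hP ha; rewrite -scaleN1r; apply: lin_closedZ. Qed.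

Lemma lin_closedB P a b : lin_closed P -> P a -> P b -> P (a - b).
Proof. by move=> hP ha hb; apply: lin_closedD => //; apply: lin_closedN. Qed.

Lemma lin_closed_sum P (I : Type) (r : seq I) (Q : pred I) (F : I -> A) :
  lin_closed P -> (forall i, Q i -> P (F i)) -> P (\sum_(i <- r | Q i) F i).
Proof.
move=> hP hF; apply: (big_ind P) => //; first by case: hP.
by move=> a b; apply: lin_closedD.
Qed.

Lemma lin_span_min S P : lin_closed P -> (forall a, S a -> P a) ->
  forall a, lin_span S a -> P a.
Proof.
move=> [h0 h] hS a; elim=> // c x y Sx _ Py.
by apply: h => //; apply: hS.
Qed.

Lemma lin_span_in S a : S a -> lin_span S a.
Proof.
by move=> Sa; rewrite -[a]scale1r -[_ *: _]addr0; apply: span_lin => //; apply: span_zero.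
Qed.

Lemma lin_span_closed S : lin_closed (lin_span S).
Proof.
split; first exact: span_zero.
move=> c a b; elim=> [|c' x y Sx _ IH] Sb; first by rewrite scaler0 add0r.
by rewrite scalerDr scalerA -addrA; apply: span_lin => //; apply: IH.
Qed.

Lemma lin_span_mono S P : (forall a, S a -> P a) -> forall a, lin_span S a -> lin_span P a.
Proof.
move=> hSP; apply: lin_span_min; first exact: lin_span_closed.
by move=> a /hSP; apply: lin_span_in.
Qed.


End LinSpan.

Lemma lin_closed_preim (A B : algType rat) (f : {linear A -> B}) (Q : B -> Prop) :
  lin_closed Q -> lin_closed (fun a => Q (f a)).
Proof.
move=> [h0 h]; split=> [|c a b ha hb]; first by rewrite linear0.
by rewrite linearP; apply: h.
Qed.

(** * Ideals and radicals relative to a commutative subalgebra *)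

Section Ideals.
Variable A : algType rat.
Implicit Types (C S J : A -> Prop) (a b c : A).

Definition gen_ideal C S := lin_span (fun y => exists c s, [/\ C c, S s & y = c * s]).

Lemma gen_ideal_closed C S : lin_closed (gen_ideal C S).
Proof. exact: lin_span_closed. Qed.

Lemma gen_ideal_in C S a : C 1 -> S a -> gen_ideal C S a.
Proof. by move=> C1 Sa; apply: lin_span_in; exists 1, a; rewrite mul1r. Qed.

Lemma gen_ideal_mull C S c a : (forall x y, C x -> C y -> C (x * y)) ->
  C c -> gen_ideal C S a -> gen_ideal C S (c * a).
Proof.
move=> CM Cc; elim=> [|k x b [c' [s [Cc' Ss ->]]] _ IH].
  by rewrite mulr0; apply: span_zero.
rewrite mulrDr -scalerAr mulrA; apply: span_lin => //.
by exists (c * c'), s; split=> //; apply: CM.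
Qed.

(** [Lambda V] is only graded-commutative, so ideals are taken relative to a commutative subalgebra,
    later the even part. *)
Definition comm_sub C :=
  [/\ lin_closed C, C 1, forall a b, C a -> C b -> C (a * b)
    & forall a b, C a -> C b -> a * b = b * a].

(** [J] may reach outside [C]: the coboundaries of [Lambda Z] form a module over the even part
    without being contained in it. *)
Definition sub_ideal C J :=
  lin_closed J /\ forall c a, C c -> J a -> J (c * a).

Definition radical C J a := C a /\ exists N, J (a ^+ N).

Variables (C J : A -> Prop).
Hypotheses (hC : comm_sub C) (hJ : sub_ideal C J).

Lemma comm_subX a N : C a -> C (a ^+ N).
Proof.
case: hC => _ C1 CM _ Ca; elim: N => [|N IH]; first by rewrite expr0.
by rewrite exprS; apply: CM.
Qed.

Lemma sub_idealX a N M : (N <= M)%N -> C a -> J (a ^+ N) -> J (a ^+ M).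
Proof.
move=> le Ca; rewrite -(subnK le) exprD; case: hJ => _ h Ja.
by apply: h => //; apply: comm_subX.
Qed.

Lemma radicalD a b : radical C J a -> radical C J b -> radical C J (a + b).
Proof.
move=> [Ca [N Ja]] [Cb [M Jb]]; case: (hC) => hl C1 CM cC; split.
  exact: lin_closedD.
exists (N + M)%N; rewrite exprDn_comm; last exact: cC.
apply: lin_closed_sum; first by case: hJ.
move=> i _; rewrite -scaler_nat; apply: lin_closedZ; first by case: hJ.
have [le|lt] := leqP M i.
  by case: hJ => _; apply; [exact: comm_subX | exact: sub_idealX Jb].
rewrite cC; try exact: comm_subX.
case: hJ => _; apply; first exact: comm_subX.
by apply: sub_idealX Ja => //; rewrite -addnBA ?leq_addr // ltnW.
Qed.

Lemma radicalMl c a : C c -> radical C J a -> radical C J (c * a).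
Proof.
move=> Cc [Ca [N Ja]]; case: (hC) => hl C1 CM cC; split; first exact: CM.
exists N; rewrite exprMn_comm; last exact: cC.
by case: hJ => _; apply=> //; apply: comm_subX.
Qed.

Lemma radical_lin : lin_closed (radical C J).
Proof.
case: (hC) => hl C1 CM cC; split.
  split; first by case: hl.
  by exists 1%N; rewrite expr1; case: hJ => -[].
move=> k a b ha hb; apply: radicalD => //.
by rewrite -[a]mul1r scalerAl; apply: radicalMl => //; apply: lin_closedZ.
Qed.

Lemma radical_in a : C a -> J a -> radical C J a.
Proof. by move=> Ca Ja; split=> //; exists 1%N; rewrite expr1. Qed.

Lemma radical_root a N : C a -> radical C J (a ^+ N) -> radical C J a.
Proof. by move=> Ca [_ [M]]; rewrite -exprM => h; split=> //; exists (N * M)%N. Qed.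

Lemma gen_ideal_radical S : (forall s, S s -> radical C J s) ->
  forall a, gen_ideal C S a -> radical C J a.
Proof.
move=> hS; apply: lin_span_min; first exact: radical_lin.
by move=> _ [c [s [Cc Ss ->]]]; apply: radicalMl => //; apply: hS.
Qed.

End Ideals.

(** * Systems of forms with finite-dimensional quotient *)

Section Counting.
Import mpoly.

(** The coefficient matrix has more rows than columns, so its left kernel is nonzero. *)
Lemma lin_dep (K : fieldType) (V : lmodType K) (I T : finType) (e : I -> V) (g : T -> V) :
  (forall i, exists c : T -> K, e i = \sum_t c t *: g t) -> (#|T| < #|I|)%N ->
  exists v : I -> K, (exists i, v i != 0) /\ \sum_i v i *: e i = 0.
Proof.
move=> /fin_all_exists [c hc] lt.
pose M : 'M[K]_(#|I|, #|T|) := \matrix_(i, t) c (enum_val i) (enum_val t).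
have: kermx M != 0.
  rewrite kermx_eq0 /row_free; apply: contraTneq lt => rk.
  by rewrite -leqNgt -rk rank_leq_col.
move=> /rowV0Pn [v /sub_kermxP vM vn0].
exists (fun i => v 0 (enum_rank i)); split.
  have /existsP [j hj]: [exists j, v 0 j != 0].
    apply: contraNT vn0 => /existsPn h; apply/eqP/rowP => j.
    by rewrite mxE; apply/eqP; move: (h j); rewrite negbK.
  by exists (enum_val j); rewrite enum_valK.
under eq_bigr do rewrite hc scaler_sumr.
rewrite exchange_big /= big1 // => t _.
under eq_bigr do rewrite scalerA.
rewrite -scaler_suml; have -> : \sum_i v 0 (enum_rank i) * c i t = (v *m M) 0 (enum_rank t).
  rewrite mxE (reindex_onto enum_val enum_rank) /=; last by move=> i _; rewrite enum_rankK.
  apply: eq_big => [i|i _]; first by rewrite enum_valK eqxx.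
  by rewrite mxE !enum_valK enum_rankK.
by rewrite vM mxE scale0r.
Qed.

(** Uniqueness of base-[K] digits; it keeps the exponents of the Kronecker substitution below
    apart. *)
Lemma digits_inj (p K : nat) (a b : 'I_p -> 'I_K) :
  (\sum_i a i * K ^ i = \sum_i b i * K ^ i)%N -> a =1 b.
Proof.
elim: p a b => [|p IH] a b; first by move=> _ [].
rewrite !big_ord_recl !expn0 !muln1.
have E (c : 'I_p.+1 -> 'I_K) : (\sum_(i < p) c (lift ord0 i) * K ^ lift ord0 i
    = (\sum_(i < p) c (lift ord0 i) * K ^ i) * K)%N.
  by rewrite big_distrl; apply: eq_bigr => i _; rewrite /= expnSr mulnA.
rewrite !E => h.
have K0 : (0 < K)%N by apply: leq_ltn_trans (ltn_ord (a ord0)).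
have h0 : a ord0 = b ord0.
  apply: val_inj; move: (congr1 (modn^~ K) h).
  by rewrite /= !(addnC (nat_of_ord _)) !modnMDl !modn_small.
move: h; rewrite h0 => /addnI /eqP; rewrite eqn_pmul2r // => /eqP /IH h i.
by case: (unliftP ord0 i) => [j|] ->.
Qed.

(** Kronecker substitution: with [t i = s ^+ (K ^ i)] the sum becomes a nonzero polynomial in [s],
    as distinct exponent vectors have distinct base-[K] values. *)
Lemma nonvanishing (p K : nat) (v : {ffun 'I_p -> 'I_K} -> rat) :
  (exists a, v a != 0) ->
  exists t : 'I_p -> rat, (forall i, t i != 0) /\
    \sum_a v a * \prod_i t i ^+ (a i) != 0.
Proof.
move=> [a0 ha0].
pose ex (a : {ffun 'I_p -> 'I_K}) := (\sum_i a i * K ^ i)%N.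
pose q : {poly rat} := \sum_a v a *: 'X^(ex a).
have qn0 : q != 0.
  apply/eqP => /(congr1 (fun r : {poly rat} => r`_(ex a0))); rewrite coef0 /q coef_sum.
  rewrite (bigD1 a0) //= coefZ coefXn eqxx mulr1 big1 ?addr0; first exact/eqP.
  move=> a ne; rewrite coefZ coefXn; case: eqP => [/esym/digits_inj e|]; last by rewrite mulr0.
  by case/eqP: ne; apply/ffunP.
have [s [s0 qs]] : exists s : rat, s != 0 /\ q.[s] != 0.
  (* The factor ['X] adds the root 0, so a non-root of [r] is also nonzero; one exists among the
     first [size r] natural numbers. *)
  pose r := q * 'X.
  have rn0 : r != 0 by rewrite mulf_neq0 // polyX_eq0.
  have: ~~ all (root r) [seq i%:R | i <- iota 0 (size r)].
    apply/negP => hall; suff: (size r < size r)%N by rewrite ltnn.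
    rewrite -[X in (X < _)%N](size_iota 0) -[X in (X < _)%N](size_map (fun i => i%:R : rat)).
    apply: max_poly_roots => //; rewrite map_inj_uniq ?iota_uniq // => x y /eqP.
    by rewrite Num.Theory.eqr_nat => /eqP.
  move=> /allPn [s _]; rewrite /root hornerM hornerX mulf_eq0 negb_or => /andP [h1 h2].
  by exists s.
exists (fun i => s ^+ (K ^ i)); split=> [i|]; first by rewrite expf_neq0.
move: qs; rewrite /q horner_sum; congr (_ != 0); apply: eq_bigr => a _.
rewrite hornerZ hornerXn /ex expr_sum; congr (_ * _); apply: eq_bigr => i _.
by rewrite -exprM mulnC.
Qed.

(** The [K ^ p] products with exponents below [K] all lie in the span of [L ^ n] monomials, and [L]
    is linear in [K] while [p > n]. *)
Lemma alg_dep (n p l : nat) (f : 'I_p -> {mpoly rat[n]}) :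
  (forall i, f i \is l.-homog) -> (n < p)%N ->
  exists K, exists v : {ffun 'I_p -> 'I_K} -> rat,
    (exists a, v a != 0) /\ \sum_a v a *: \prod_i f i ^+ a i = 0.
Proof.
(* [K] exceeds [(l * p).+1 ^ n], whence [L ^ n <= ((l * p).+1 * K) ^ n < K ^ n.+1 <= K ^ p]. The
   products have degree at most [l * p * K], which fixes [L]. *)
move=> hf lt; pose K := ((l * p).+1 ^ n).+1; exists K.
pose L := (l * p * K).+1.
pose g (b : {ffun 'I_n -> 'I_L}) : {mpoly rat[n]} := 'X_[[multinom (b i : nat) | i < n]].
apply: (@lin_dep _ _ _ _ _ g) => [a|]; last first.
  rewrite !card_ffun !card_ord.
  apply: (@leq_trans (K ^ n.+1)); last by rewrite leq_pexp2l.
  have: (L ^ n <= ((l * p).+1 * K) ^ n)%N.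
    by case: (n) => [|n'] //; rewrite leq_exp2r // /L mulSn addSn ltnS leq_addl.
  rewrite expnMn expnS => /leq_ltn_trans; apply.
  by rewrite ltn_pmul2r ?expn_gt0 //.
set P := \prod_i _.
have hP : P \is (l * \sum_i a i).-homog.
  rewrite /P big_distrr /=; elim/big_rec2: _ => [|i m q _ hq]; first exact: dhomog1.
  by apply: dhomogM => //; apply: dhomogMn.
exists (fun b : {ffun 'I_n -> 'I_L} => P@_[multinom (b i : nat) | i < n]).
apply/mpolyP => m; rewrite raddf_sum /=.
under eq_bigr do rewrite mcoeffZ mcoeffX.
have [e|ne] := eqVneq (mdeg m) (l * \sum_i a i)%N; last first.
  rewrite (dhomog_nemf_coeff hP) // big1 // => b _.
  by case: eqP => [->|_]; rewrite ?mulr0 // (dhomog_nemf_coeff hP) // mul0r.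
have hm i : (m i < L)%N.
  rewrite ltnS; apply: (@leq_trans (mdeg m)).
    by rewrite mdegE (bigD1 i) //= leq_addr.
  rewrite e -mulnA leq_mul2l; apply/orP; right.
  rewrite -[X in (_ <= X * _)%N](card_ord p) -sum_nat_const leq_sum // => j _.
  exact: ltnW.
rewrite (bigD1 [ffun i => Ordinal (hm i)]) //= big1 ?addr0.
  have -> : [multinom ([ffun i => Ordinal (hm i)] i : nat) | i < n]%MM = m.
    by apply/mnmP => i; rewrite mnmE ffunE.
  by rewrite eqxx mulr1.
move=> b ne; case: eqP => [E|]; last by rewrite mulr0.
case/eqP: ne; apply/ffunP => i; apply: val_inj.
by rewrite ffunE /= -E mnmE.
Qed.

End Counting.

Lemma lin_span_fin (A : algType rat) (S : A -> Prop) (T : finType) (g : T -> A) :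
  (forall a, S a -> exists t, a = g t) ->
  forall a, lin_span S a -> exists c : T -> rat, a = \sum_t c t *: g t.
Proof.
move=> hS a; elim=> [|c x y /hS [t ->] _ [c' ->]].
  by exists (fun _ => 0); rewrite big1 // => t _; rewrite scale0r.
exists (fun s => c * (s == t)%:R + c' s).
under [RHS]eq_bigr do rewrite scalerDl; rewrite big_split /=; congr (_ + _).
rewrite (bigD1 t) //= eqxx mulr1 big1 ?addr0 // => s /negbTE ->.
by rewrite mulr0 scale0r.
Qed.

Section Forms.
Import mpoly.
Variables (n l : nat) (W : vectType rat) (phi : {linear W -> {mpoly rat[n]}}).
Hypotheses (l_gt0 : (0 < l)%N) (phi_homog : forall w, phi w \is l.-homog).
Implicit Types U : {vspace W}.

Definition form_ideal U : {mpoly rat[n]} -> Prop :=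
  gen_ideal (fun _ => True) (fun s => exists2 u, u \in U & s = phi u).

(** For an ideal generated by forms, nilpotency of every variable is equivalent to finite dimension
    of the quotient ring. *)
Definition finite_quotient U := forall i : 'I_n, exists N, form_ideal U ('X_i ^+ N).

Lemma mpoly_comm_sub : comm_sub (fun _ : {mpoly rat[n]} => True).
Proof. by split=> // a b _ _; apply: mulrC. Qed.

Lemma form_ideal_sub_ideal U : sub_ideal (fun _ => True) (form_ideal U).
Proof. by split=> [|c a _]; [exact: gen_ideal_closed | exact: gen_ideal_mull]. Qed.

Lemma form_ideal_mull U c a : form_ideal U a -> form_ideal U (c * a).
Proof. by case: (form_ideal_sub_ideal U) => _; apply. Qed.

(** Once coefficients are expanded into monomials and forms into the basis of [U], all products are
    homogeneous, and taking a component merely selects some of them. *)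
Lemma form_ideal_pihomog U d x : form_ideal U x ->
  lin_span (fun y => exists m (j : 'I_(\dim U)), (mdeg m + l)%N = d /\
      y = 'X_[m] * phi (vbasis U)`_j) (pihomog mdeg d x).
Proof.
move: x; apply: lin_span_min.
  by apply: (@lin_closed_preim _ _ (pihomog mdeg d)); apply: lin_span_closed.
move=> _ [q [_ [_ [u uU ->] ->]]].
rewrite (mpolyE q) mulr_suml linear_sum /=.
apply: lin_closed_sum; first exact: lin_span_closed.
move=> m _; rewrite -scalerAl linearZ; apply: lin_closedZ; first exact: lin_span_closed.
have hom : 'X_[m] * phi u \is (mdeg m + l).-homog by rewrite dhomogM // dhomogX.
have [e|ne] := eqVneq (mdeg m + l)%N d; last first.
  have [-> | nz] := eqVneq ('X_[m] * phi u) 0.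
    by rewrite linear0; apply: span_zero.
  by rewrite /= (pihomog_ne0 ne hom); apply: span_zero.
rewrite /= pihomog_dE -?e // [u in phi u](coord_vbasis uU) linear_sum /= mulr_sumr.
apply: lin_closed_sum; first exact: lin_span_closed.
move=> j _; rewrite linearZ -scalerAr; apply: lin_closedZ; first exact: lin_span_closed.
by apply: lin_span_in; exists m, j; split.
Qed.

Lemma form_ideal_homog U d x : form_ideal U x -> form_ideal U (pihomog mdeg d x).
Proof.
move=> /form_ideal_pihomog - /(_ d); apply: lin_span_min; first exact: gen_ideal_closed.
move=> _ [m [j [_ ->]]]; apply: lin_span_in; exists 'X_[m], (phi (vbasis U)`_j); split=> //.
by exists (vbasis U)`_j => //; apply/vbasis_mem/mem_nth; rewrite size_tuple.
Qed.

(** The ideal is homogeneous, so it contains the component of degree [k * M] of the sum. Since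
    [k > 0] separates the powers of [g], this component is [g ^+ M] times the given coefficient
    sum. *)
Lemma form_ideal_power U (I : finType) (c : I -> rat) (e : I -> nat) g k M :
  (0 < k)%N -> g \is k.-homog -> form_ideal U (\sum_a c a *: g ^+ e a) ->
  \sum_(a | e a == M) c a != 0 -> form_ideal U (g ^+ M).
Proof.
move=> k0 hg /form_ideal_homog - /(_ (k * M)%N).
have hX j : g ^+ j \is (k * j).-homog by apply: dhomogMn.
rewrite linear_sum /= (bigID (fun a => e a == M)) /= [X in _ + X]big1 ?addr0; last first.
  move=> a ne; rewrite linearZ /=; have [-> | nz] := eqVneq (g ^+ e a) 0.
    by rewrite linear0 scaler0.
  by rewrite (pihomog_ne0 _ (hX _)) ?scaler0 // eqn_pmul2l.
under eq_bigr => a /eqP -> do rewrite linearZ /= pihomog_dE //.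
rewrite -scaler_suml => h nz.
rewrite -[g ^+ M]scale1r -(mulVf nz) -scalerA; apply: lin_closedZ => //.
exact: gen_ideal_closed.
Qed.

(** With [p < n] forms, every monomial of degree O(K) is a combination of boundedly many reduced
    monomials times products of the forms. There are only O(K^p) such terms, against K^n independent
    monomials. *)
Lemma finite_quotient_dim U : finite_quotient U -> (n <= \dim U)%N.
Proof.
move=> /fin_all_exists [N0 hN0]; rewrite leqNgt; apply/negP => lt.
pose N := (\max_i N0 i).+1; pose p := \dim U.
have hN i : form_ideal U ('X_i ^+ N).
  apply: (sub_idealX mpoly_comm_sub (form_ideal_sub_ideal U) _ _ (hN0 i)) => //.
  by rewrite (leq_trans (leq_bigmax i)).
pose f (j : 'I_p) := phi (vbasis U)`_j.
pose mon (a : 'I_n -> nat) (b : 'I_p -> nat) :=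
  'X_[[multinom a i | i < n]] * \prod_j f j ^+ b j.
pose S d y := exists a b, [/\ forall i, (a i < N)%N, (\sum_j b j <= d)%N & y = mon a b].
(* A monomial with an exponent at least [N] lies in the ideal, so it is a combination of products of
   a form with a monomial of degree smaller by [l]; induction applies to the latter. *)
have claim d m : mdeg m = d -> lin_span (S d) 'X_[m].
  elim/ltn_ind: d m => d IH m md.
  have [/forallP h|] := boolP [forall i, (m i < N)%N].
    apply: lin_span_in; exists m, (fun _ => 0%N); split=> //; first by rewrite big1.
    rewrite /mon big1 ?mulr1 //; congr mpolyX.
    by apply/mnmP => i; rewrite mnmE.
  rewrite negb_forall => /existsP [i]; rewrite -leqNgt => hi.
  have : form_ideal U 'X_[m].
    have -> : m = ((m - U_(i) *+ N) + U_(i) *+ N)%MM.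
      apply/mnmP => j; rewrite mnmDE mnmBE mulmnE mnm1E.
      by case: eqP => [<-|_]; rewrite ?mul1n ?mul0n ?subnK ?subn0 ?addn0.
    by rewrite mpolyXD -mpolyXn; apply: form_ideal_mull.
  move=> /form_ideal_pihomog - /(_ d); rewrite pihomog_dE; last by rewrite dhomogX; apply/eqP.
  apply: lin_span_min; first exact: lin_span_closed.
  move=> _ [m' [j [hm' ->]]].
  have lt' : (mdeg m' < d)%N by rewrite -hm' -addn1 leq_add2l.
  have := IH _ lt' m' erefl.
  elim=> [|c x y [a [b [ha hb ->]]] _]; first by rewrite mul0r; apply: span_zero.
  move=> IHy; rewrite mulrDl -scalerAl; apply: span_lin => //.
  exists a, (fun k => b k + (k == j))%N; split=> //.
    rewrite big_split /= -(leq_add2r (l - 1)).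
    have -> : (\sum_k (k == j) = 1)%N.
      by rewrite (bigD1 j) //= eqxx big1 ?addn0 // => k /negbTE ->.
    rewrite -addnA subnKC // -hm' (leq_trans _ (leq_addr _ _)) //.
    by rewrite leq_add2r.
  rewrite /mon -mulrA; congr (_ * _).
  rewrite (bigD1 j) //= [RHS](bigD1 j) //= eqxx addn1 exprSr mulrAC; congr (_ * _).
  by apply: eq_bigr => k /negbTE ->; rewrite addn0.
(* Since [D.+1 <= n.+1 * K], the spanning terms number at most [N ^ n * n.+1 ^ p * K ^ p], which is
   below [K ^ p.+1] by the choice of [K]. *)
pose K := (N ^ n * n.+1 ^ p).+1; pose D := (n * K)%N.
pose e (a : {ffun 'I_n -> 'I_K}) : {mpoly rat[n]} := 'X_[[multinom (a i : nat) | i < n]].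
pose g (ab : {ffun 'I_n -> 'I_N} * {ffun 'I_p -> 'I_D.+1}) :=
  mon (fun i => ab.1 i) (fun i => ab.2 i).
have [||v [[a0 va0]]] := @lin_dep _ _ _ _ e g.
- move=> a; apply: (@lin_span_fin _ (S D)); last first.
    have le : (mdeg [multinom (a i : nat) | i < n] <= D)%N.
      rewrite mdegE /D -[X in (_ <= X * _)%N](card_ord n) -sum_nat_const leq_sum => // k _.
      by rewrite mnmE ltnW.
    apply: lin_span_mono (claim _ _ erefl) => y [a' [b [h1 h2 ->]]].
    by exists a', b; split=> //; apply: leq_trans le.
  move=> _ [a' [b [ha hb ->]]].
  have hb' j : (b j < D.+1)%N by rewrite ltnS (leq_trans _ hb) // (bigD1 j) //= leq_addr.
  exists ([ffun i => Ordinal (ha i)], [ffun j => Ordinal (hb' j)]).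
  rewrite /g /mon; congr (mpolyX _ _ * _); first by apply/mnmP => i; rewrite !mnmE ffunE.
  by apply: eq_bigr => j _; rewrite ffunE.
- rewrite card_prod !card_ffun !card_ord.
  apply: (@leq_ltn_trans (N ^ n * (n.+1 * K) ^ p)).
    rewrite leq_mul2l; apply/orP; right.
    case: (p) => [|p'] //; rewrite leq_exp2r // mulSn addnC -addn1 leq_add2l //.
  rewrite expnMn mulnA; apply: (@leq_trans (K ^ p.+1)); last by rewrite leq_pexp2l.
  by rewrite expnS ltn_pmul2r ?expn_gt0.
move/(congr1 (mcoeff [multinom (a0 i : nat) | i < n])).
rewrite mcoeff0 raddf_sum (bigD1 a0) //= mcoeffZ mcoeffX eqxx mulr1 big1 ?addr0; first exact/eqP.
move=> a ne; rewrite mcoeffZ mcoeffX; case: eqP => [E|]; last by rewrite mulr0.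
case/eqP: ne; apply/ffunP => i; apply: val_inj.
by move/mnmP/(_ i): E; rewrite !mnmE.
Qed.

(** Modulo the forms of the hyperplane [ker T] of [U], each [phi u] equals [T u] times one form [g].
    The algebraic dependency thus becomes a relation between powers of [g], nontrivial because it
    does not vanish at [t]. Hence [g], then every [phi u], then every variable is nilpotent modulo
    the hyperplane. *)
Lemma finite_quotient_reduce U : finite_quotient U -> (n < \dim U)%N ->
  exists2 U' : {vspace W}, (\dim U').+1 = \dim U & finite_quotient U'.
Proof.
move=> fU lt; pose p := \dim U; pose w (j : 'I_p) := (vbasis U)`_j.
have wU j : w j \in U by apply/vbasis_mem/mem_nth; rewrite size_tuple.
have [K [v [v0 vP]]] := alg_dep (f := fun j => phi (w j)) (fun j => phi_homog _) lt.
have [t [t0 tP]] := nonvanishing v0.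
pose T0 (x : W) : rat^o := \sum_j coord (vbasis U) j x * t j.
have T0_lin : linear T0.
  move=> c x y; rewrite /T0 scaler_sumr -big_split; apply: eq_bigr => j _ /=.
  by rewrite linearP /GRing.scale /= mulrDl mulrA.
pose HT := GRing.isLinear.Build _ _ _ _ T0 T0_lin.
pose TL : {linear W -> rat^o} := HB.pack T0 HT.
pose T := linfun TL.
have Tw j : T (w j) = t j.
  rewrite lfunE /= /T0 (bigD1 j) //= coord_free ?eqxx ?(basis_free (vbasisP U)) //.
  rewrite mul1r big1 ?addr0 // => i ne.
  by rewrite coord_free ?(basis_free (vbasisP U)) // eq_sym (negbTE ne) mul0r.
pose j0 : 'I_p := Ordinal (leq_ltn_trans (leq0n n) lt).
pose w0 := (t j0)^-1 *: w j0.
have w0U : w0 \in U by apply: memvZ.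
have Tw0 : T w0 = 1 by rewrite linearZ /= Tw /GRing.scale /= mulVf.
exists (U :&: lker T)%VS.
  rewrite -(limg_ker_dim T U) -addn1; congr (_ + _)%N; apply/esym/eqP; rewrite eqn_leq.
  rewrite (leq_trans (dimvS (subvf _))) ?dimvf //=.
  rewrite lt0n dimv_eq0; apply: contraTneq (memv_img T w0U) => ->.
  by rewrite memv0 Tw0 oner_eq0.
set U' := (U :&: lker T)%VS; set g := phi w0.
have lc := gen_ideal_closed (fun _ => True) (fun s => exists2 u, u \in U' & s = phi u).
have cg u : u \in U -> form_ideal U' (phi u - T u *: g).
  move=> uU; rewrite -linearZ -linearB; apply: gen_ideal_in => //.
  exists (u - T u *: w0) => //; rewrite memv_cap memv_ker rpredB ?rpredZ //= linearB linearZ /= Tw0.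
  by rewrite /GRing.scale /= mulr1 subrr.
have congM x y x' y' : form_ideal U' (x - x') -> form_ideal U' (y - y') ->
    form_ideal U' (x * y - x' * y').
  move=> h1 h2; have -> : x * y - x' * y' = y * (x - x') + x' * (y - y').
    by rewrite !mulrBr [y * x]mulrC [y * x']mulrC addrA subrK.
  by apply: lin_closedD => //; apply: form_ideal_mull.
have cong0 x : form_ideal U' (x - x) by rewrite subrr; case: lc.
have congX x y k : form_ideal U' (x - y) -> form_ideal U' (x ^+ k - y ^+ k).
  by move=> h; elim: k => [|k IH]; rewrite ?expr0 // !exprS; apply: congM.
have gN : radical (fun _ => True) (form_ideal U') g.
  split=> //.
  pose c a := v a * \prod_i t i ^+ a i.
  pose e (a : {ffun 'I_p -> 'I_K}) := (\sum_i a i)%N.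
  have h : form_ideal U' (\sum_a c a *: g ^+ e a).
    have -> : \sum_a c a *: g ^+ e a =
        - \sum_a (v a *: \prod_i phi (w i) ^+ a i - c a *: g ^+ e a).
      by rewrite sumrB vP sub0r opprK.
    apply: lin_closedN => //; apply: lin_closed_sum => // a _.
    rewrite /c -scalerA -scalerBr; apply: lin_closedZ => //.
    have -> : (\prod_i t i ^+ a i) *: g ^+ e a = \prod_i (t i *: g) ^+ a i.
      under [RHS]eq_bigr do rewrite exprZn.
      by rewrite scaler_prod expr_sum.
    apply: (big_ind2 (fun x y => form_ideal U' (x - y))) => // [x1 x2 y1 y2|i _].
      exact: congM.
    by apply: congX; rewrite -Tw; apply: cg.
  (* The sum of all [c a] is the value of the dependency at [t]; grouped by total exponent, some
     group has a nonzero sum. *)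
  have [M hM] : exists M, \sum_(a | e a == M) c a != 0.
    have e_lt a : (e a < (p * K).+1)%N.
      rewrite ltnS /e -[X in (_ <= X * _)%N](card_ord p) -sum_nat_const leq_sum => // k _.
      exact: ltnW.
    have /existsP [M hM] : [exists M : 'I_(p * K).+1, \sum_(a | e a == M) c a != 0].
      apply: contraNT tP => /existsPn hn.
      rewrite (partition_big (fun a => Ordinal (e_lt a)) xpredT) //= big1 // => M _.
      by apply/eqP; move: (hn M); rewrite negbK.
    by exists (val M).
  by exists M; exact: form_ideal_power l_gt0 (phi_homog w0) h hM.
have rad u : u \in U -> radical (fun _ => True) (form_ideal U') (phi u).
  move=> uU; rewrite -[phi u](subrK (T u *: g)).
  have rl := radical_lin mpoly_comm_sub (form_ideal_sub_ideal U').
  apply: lin_closedD => //; first by apply: radical_in => //; apply: cg.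
  exact: lin_closedZ.
move=> i; have [N hN] := fU i.
have [_ [M hM]] : radical (fun _ => True) (form_ideal U') ('X_i).
  apply: (@radical_root _ _ _ _ N) => //.
  apply: (gen_ideal_radical mpoly_comm_sub (form_ideal_sub_ideal U')) hN.
  by move=> _ [u uU ->]; apply: rad.
by exists M.
Qed.

(** Hyperplanes are taken one after another; [finite_quotient_dim] keeps the descent from passing
    below [n]. *)
Lemma regular_subspace U : finite_quotient U ->
  exists2 U' : {vspace W}, \dim U' = n & finite_quotient U'.
Proof.
move: {2}(\dim U - n)%N (erefl (\dim U - n)%N) => k.
elim: k U => [|k IH] U hk fU.
  exists U => //; apply/eqP; rewrite eqn_leq finite_quotient_dim // andbT.
  by rewrite -subn_eq0 hk.
have lt : (n < \dim U)%N by rewrite -subn_gt0 hk.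
have [U' dU' fU'] := finite_quotient_reduce fU lt.
by apply: (IH U') => //; move: hk; rewrite -dU' subSn ?finite_quotient_dim // => -[].
Qed.

End Forms.

(** * Graded-commutative algebras *)

Section Graded.
Variables (A : algType rat) (G : nat -> A -> Prop).

(** Terms are sorted by degree without leaving the span of [S], so that homogeneous components of
    elements of [Lambda Z] stay in [Lambda Z]. *)
Lemma lin_span_homog (S : A -> Prop) : (forall a, S a -> exists k, G k a) ->
  forall a, lin_span S a -> exists N (c : nat -> A),
    [/\ forall k, lin_span (fun x => S x /\ G k x) (c k),
        forall k, (N <= k)%N -> c k = 0 & a = \sum_(k < N) c k].
Proof.
move=> hS a; elim=> [|q x y Sx _ [N [c [h1 h2 ->]]]].
  exists 0%N, (fun _ => 0); split=> //; last by rewrite big_ord0.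
  by move=> k; apply: span_zero.
have [k Gx] := hS x Sx.
exists (maxn N k.+1), (fun j => (j == k)%:R *: (q *: x) + c j); split.
- move=> j; case: eqP => [->|_]; last by rewrite scale0r add0r.
  by rewrite scale1r; apply: span_lin.
- move=> j; rewrite geq_max => /andP [h3 h4].
  by rewrite gtn_eqF // scale0r add0r h2.
rewrite big_split /=; congr (_ + _).
  have lt : (k < maxn N k.+1)%N by rewrite leq_max leqnn orbT.
  rewrite (bigD1 (Ordinal lt)) //= eqxx scale1r big1 ?addr0 // => j ne.
  by have /negbTE -> : (j : nat) != k by []; rewrite scale0r.
rewrite -!(big_mkord xpredT c) [RHS](big_cat_nat (leq0n N)) ?leq_maxl //=.
rewrite [X in _ = _ + X]big_nat [X in _ = _ + X]big1 ?addr0 // => j /andP [h3 _].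
exact: h2.
Qed.

Hypothesis gca : graded_comm_algebra G.

Lemma homog_closed k : lin_closed (G k).
Proof. by split=> [|c a b]; [exact: (gca_zero gca) | exact: (gca_lin gca)]. Qed.

(** Subtracting the whole sum in degree [D] gives a family with sum zero, to which directness
    applies. For [D >= N] the component is absent, hence the value 0. *)
Lemma homog_component N (c : nat -> A) D :
  (forall k, G k (c k)) -> G D (\sum_(k < N) c k) ->
  \sum_(k < N) c k = if (D < N)%N then c D else 0.
Proof.
move=> hc hD; set u := \sum_(k < N) c k.
pose c' k := (if (k < N)%N then c k else 0) - (if k == D then u else 0).
have hc' k : G k (c' k).
  apply: lin_closedB; first exact: homog_closed.
    by case: ifP => // _; case: (homog_closed k).
  by case: eqP => [->|] //; case: (homog_closed k).
pose N' := maxn N D.+1.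
have lt : (D < N')%N by rewrite leq_max leqnn orbT.
have s0 : \sum_(k < N') c' k = 0.
  rewrite sumrB; apply/eqP; rewrite subr_eq0; apply/eqP.
  transitivity u.
    rewrite -(big_mkord xpredT (fun k => if (k < N)%N then c k else 0)).
    rewrite (big_cat_nat (leq0n N)) ?leq_maxl //=.
    rewrite [X in _ + X]big_nat [X in _ + X]big1 ?addr0; last first.
      by move=> j /andP [h3 _]; rewrite ltnNge h3.
    by rewrite big_mkord; apply: eq_bigr => i _; rewrite ltn_ord.
  rewrite (bigD1 (Ordinal lt)) //= eqxx big1 ?addr0 // => j ne.
  by have /negbTE -> : (j : nat) != D by [].
have := gca_direct gca hc' s0 lt.
by rewrite /c' eqxx => /eqP; rewrite subr_eq0 => /eqP.
Qed.

Lemma homog_lin_span (S : A -> Prop) D u : (forall a, S a -> exists k, G k a) ->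
  lin_span S u -> G D u -> lin_span (fun x => S x /\ G D x) u.
Proof.
move=> hS /(lin_span_homog hS) [N [c [h1 h2 ->]]].
have hc k : G k (c k).
  by apply: lin_span_min (h1 k); [exact: homog_closed | move=> a []].
move=> /(homog_component hc) ->; case: ifP => _; [exact: h1 | exact: span_zero].
Qed.

Lemma gca_lin_span a : lin_span (fun x => exists k, G k x) a.
Proof.
have [N [c [hc ->]]] := gca_span gca a.
apply: lin_closed_sum; first exact: lin_span_closed.
by move=> i _; apply: lin_span_in; exists i.
Qed.

Lemma even_central p a b : ~~ odd p -> G p a -> a * b = b * a.
Proof.
move=> ep Ga; move: b (gca_lin_span b); apply: lin_span_min.
  split=> [|c x y hx hy]; first by rewrite mulr0 mul0r.
  by rewrite mulrDr mulrDl -scalerAr -scalerAl hx hy.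
move=> b [q Gb]; rewrite (gca_comm gca Ga Gb) -signr_odd oddM (negbTE ep) /=.
by rewrite expr0 scale1r.
Qed.

Lemma odd_square p a : odd p -> G p a -> a * a = 0.
Proof.
move=> op Ga; have := gca_comm gca Ga Ga.
rewrite -signr_odd oddM op /= expr1 scaleN1r => /eqP; rewrite -addr_eq0 -mulr2n.
by rewrite -scaler_nat scaler_eq0 => /orP [] // /eqP.
Qed.

Lemma homogX p a N : G p a -> G (p * N)%N (a ^+ N).
Proof.
move=> Ga; elim: N => [|N IH]; first by rewrite muln0 expr0; apply: gca_one gca.
by rewrite mulnS exprS; exact: (gca_mul gca Ga IH).
Qed.

End Graded.

(* [{poly A}] as an algebra over the rationals: its library structure is only
   that of a left [A]-algebra. *)
Definition polyalg (A : algType rat) : Type := {poly A}.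

HB.instance Definition _ (A : algType rat) := GRing.NzRing.copy (polyalg A) {poly A}.

Section PolyAlg.
Variable A : algType rat.
Local Notation PA := (polyalg A).
Implicit Types p q : PA.

Definition polyalg_scale (c : rat) p : PA := (c%:A : A) *: (p : {poly A}).

Fact polyalg_scaleA a b p : polyalg_scale a (polyalg_scale b p) = polyalg_scale (a * b) p.
Proof. by rewrite /polyalg_scale scalerA -scalerAl mul1r scalerA. Qed.

Fact polyalg_scale1 : left_id 1 polyalg_scale.
Proof. by move=> p; rewrite /polyalg_scale !scale1r. Qed.

Fact polyalg_scaleDr : right_distributive polyalg_scale +%R.
Proof. by move=> c p q; rewrite /polyalg_scale scalerDr. Qed.

Fact polyalg_scaleDl p : {morph polyalg_scale^~ p : a b / a + b}.
Proof. by move=> a b; rewrite /polyalg_scale -scalerDl -[in RHS]scalerDl. Qed.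

HB.instance Definition _ := GRing.Zmodule_isLmodule.Build rat PA
  polyalg_scaleA polyalg_scale1 polyalg_scaleDr polyalg_scaleDl.

Fact polyalg_scaleAl (c : rat) p q : c *: (p * q) = c *: p * q.
Proof. exact: (@scalerAl A {poly A}). Qed.

HB.instance Definition _ := GRing.Lmodule_isLalgebra.Build rat PA polyalg_scaleAl.

Lemma coef_polyalg_scale (c : rat) p i : (c *: p : {poly A})`_i = c *: (p : {poly A})`_i.
Proof. by rewrite [LHS]coefZ -scalerAl mul1r. Qed.

Fact polyalg_scaleAr (c : rat) p q : c *: (p * q) = p * (c *: q).
Proof.
apply/(@polyP A) => i; rewrite coef_polyalg_scale !coefM scaler_sumr.
by apply: eq_bigr => j _; rewrite coef_polyalg_scale scalerAr.
Qed.

HB.instance Definition _ := GRing.Lalgebra_isAlgebra.Build rat PA polyalg_scaleAr.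

Variables (G : nat -> A -> Prop) (e : nat).
Hypotheses (gca : graded_comm_algebra G) (even_e : ~~ odd e).

(** The grading with ['X] in degree [e]. The test [e * i <= k] guards against truncated subtraction,
    which would admit coefficients of degree 0. *)
Definition polyalg_homog (k : nat) p :=
  forall i, if (e * i <= k)%N then G (k - e * i) (p : {poly A})`_i else (p : {poly A})`_i = 0.

Lemma polyalg_gca : graded_comm_algebra polyalg_homog.
Proof.
have G0 k : G k 0 by apply: gca_zero gca _.
have homog_coef k p i : polyalg_homog k p -> (e * i <= k)%N -> G (k - e * i) (p : {poly A})`_i.
  by move=> /(_ i) h le; rewrite le in h.
have homog_coef0 k p i : polyalg_homog k p -> ~~ (e * i <= k)%N -> (p : {poly A})`_i = 0.
  by move=> /(_ i) h /negbTE le; rewrite le in h.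
have zero k : polyalg_homog k 0 by move=> i; rewrite coef0; case: ifP.
have lin k c p q : polyalg_homog k p -> polyalg_homog k q -> polyalg_homog k (c *: p + q).
  move=> hp hq i; rewrite (@coefD A) coef_polyalg_scale.
  case: ifP => le; first by apply: (gca_lin gca); [apply: homog_coef | apply: homog_coef].
  by rewrite !(homog_coef0 k) ?le // scaler0 addr0.
split=> //.
- case=> [|i]; first by rewrite muln0 coef1; apply: gca_one gca.
  by rewrite coef1 /=; case: ifP.
- move=> k k' p q hp hq i; rewrite coefM.
  have hj (j : 'I_i.+1) : (e * i = e * j + e * (i - j))%N.
    by rewrite -mulnDr subnKC // -ltnS.
  case: ifP => le.
    apply: lin_closed_sum; first exact: homog_closed.
    move=> j _; have [le1|lt1] := boolP (e * j <= k)%N; last first.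
      by rewrite (homog_coef0 _ _ _ hp lt1) mul0r.
    have [le2|lt2] := boolP (e * (i - j) <= k')%N; last first.
      by rewrite (homog_coef0 _ _ _ hq lt2) mulr0.
    have -> : (k + k' - e * i = (k - e * j) + (k' - e * (i - j)))%N.
      by rewrite (hj j) subnDA (addnBA _ le2) (addnBAC _ le1).
    by apply: (gca_mul gca); apply: homog_coef.
  rewrite big1 // => j _.
  have [le1|lt1] := boolP (e * j <= k)%N; last by rewrite (homog_coef0 _ _ _ hp lt1) mul0r.
  have [le2|lt2] := boolP (e * (i - j) <= k')%N; last first.
    by rewrite (homog_coef0 _ _ _ hq lt2) mulr0.
  by move: le; rewrite (hj j) leq_add.
- move=> p.
  have hX x i k : G k x -> polyalg_homog (k + e * i)%N (x *: 'X^i : {poly A}).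
    move=> Gx j; rewrite coefZ coefXn.
    case: eqP => [->|_]; last by rewrite mulr0; case: ifP.
    by rewrite mulr1 leq_addl addnK.
  have: lin_span (fun x => exists k, polyalg_homog k x) p.
    rewrite -[p](@coefK A) (@poly_def A).
    apply: (@lin_closed_sum PA); first exact: lin_span_closed.
    move=> i _; move: (p : {poly A})`_i (gca_lin_span gca (p : {poly A})`_i).
    apply: (@lin_span_min A _ (fun y =>
      lin_span (fun x : PA => exists k, polyalg_homog k x) (y *: 'X^i : {poly A})))
      => [|x [k Gx]]; last first.
      by apply: lin_span_in; exists (k + e * i)%N; apply: hX.
    have [h0 h1] := @lin_span_closed PA (fun x => exists k, polyalg_homog k x).
    split=> [|c x y hx hy]; first by rewrite scale0r.
    rewrite scalerDl; have -> : (c *: x) *: 'X^i = c *: (x *: 'X^i : PA) :> PA.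
      by rewrite [RHS](@scalerA A {poly A}) -scalerAl mul1r.
    exact: h1.
  move=> /lin_span_homog h; case: (h polyalg_homog) => // N [c [h1 h2 ->]].
  exists N, c; split=> // k; move: (c k) (h1 k); apply: lin_span_min => [|x []] //.
  by split=> [|d x y]; [exact: zero | exact: lin].
- move=> N c hc h0 k lt; apply/(@polyP A) => i; rewrite coef0.
  have [le|nle] := boolP (e * i <= k)%N; last exact: homog_coef0 (hc k) nle.
  (* In the component of degree [j + e * i] the coefficient of ['X^i] has degree [j], so directness
     in [A] applies to these coefficients. *)
  pose c' j : A := (c (j + e * i)%N : {poly A})`_i.
  have hc' j : G j (c' j).
    by rewrite -[j in G j](addnK (e * i)); apply: homog_coef; rewrite ?leq_addl.
  rewrite -(subnK le); apply: (gca_direct gca hc' (N := (N - e * i)%N)); last first.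
    by rewrite ltn_sub2r // (leq_ltn_trans le).
  have := congr1 (fun q : {poly A} => q`_i) h0; rewrite coef0 (@coef_sum A).
  rewrite -(big_mkord xpredT (fun j => (c j : {poly A})`_i)).
  rewrite (big_cat_nat (leq0n (e * i))) /=; last exact: leq_trans (ltnW lt).
  rewrite [X in X + _]big_nat [X in X + _]big1 ?add0r; last first.
    by move=> j lt'; apply: homog_coef0 (hc j) _; rewrite -ltnNge.
  by rewrite -{1}[(e * i)%N]add0n big_addn big_mkord.
- move=> k k' p q hp hq; apply/(@polyP A) => i; rewrite coef_polyalg_scale.
  rewrite coefM coefMr scaler_sumr; apply: eq_bigr => j _.
  have [le1|lt1] := boolP (e * j <= k)%N; last first.
    by rewrite (homog_coef0 _ _ _ hp lt1) mul0r mulr0 scaler0.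
  have [le2|lt2] := boolP (e * (i - j) <= k')%N; last first.
    by rewrite (homog_coef0 _ _ _ hq lt2) mul0r mulr0 scaler0.
  rewrite (gca_comm gca (homog_coef _ _ _ hp le1) (homog_coef _ _ _ hq le2)).
  (* As [e] is even, shifting degrees by multiples of [e] leaves the sign unchanged. *)
  by rewrite -signr_odd -[in RHS]signr_odd !oddM !oddB // !oddM (negbTE even_e) /= !addbF.
Qed.

End PolyAlg.

Section Override.
Variables (V : nat -> vectType rat) (B : algType rat).

Definition override (g : forall k, {linear V k -> B}) e (f : {linear V e -> B}) k :
    {linear V k -> B} :=
  match @eqP _ e k with
  | ReflectT E => eq_rect e (fun j => {linear V j -> B}) f k E
  | ReflectF _ => g k
  end.

Lemma override_eq g e (f : {linear V e -> B}) v : override g f e v = f v.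
Proof.
rewrite /override; case: eqP => // E.
by rewrite (eq_irrelevance E erefl).
Qed.

Lemma override_neq g e (f : {linear V e -> B}) k v : e != k -> override g f k v = g k v.
Proof. by rewrite /override; case: eqP. Qed.

End Override.

(** * Finiteness of cohomology *)

Section FiniteIndex.
Variable A : algType rat.
Implicit Types P Q : A -> Prop.

(** For linear [P] and [Q]: the image of [P] in [A / Q] is finite-dimensional, said without forming
    quotients. *)
Definition finite_index P Q := exists n (h : 'I_n -> A),
  (forall i, P (h i)) /\ forall a, P a -> exists c : 'I_n -> rat, Q (a - \sum_i c i *: h i).

(** [P] modulo [Q] is a quotient of [P] modulo [Q'], which embeds into [P'] modulo [Q']. The
    generators for [P'] may lie outside [P], so new ones are built by induction on their number. *)
Lemma finite_index_sub P Q P' Q' :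
  lin_closed P -> lin_closed Q -> lin_closed Q' -> (forall a, P a -> P' a) ->
  (forall a, P a -> Q' a -> Q a) -> finite_index P' Q' -> finite_index P Q.
Proof.
move=> hP hQ hQ' PP' PQ [n [h [_ hh]]].
have {}hh a : P a -> exists c : 'I_n -> rat, Q' (a - \sum_i c i *: h i).
  by move=> /PP'; apply: hh.
elim: n h P hP {PP'} PQ hh => [|n IH] h P hP PQ hh.
  exists 0%N, h; split=> [[]|] // a Pa; have [c hc] := hh a Pa.
  by exists c; apply: PQ; rewrite big_ord0 subr0 // in hc *.
pose h' i := h (lift ord0 i).
(* Gaussian elimination: either the first generator never occurs for elements of [P] and is dropped,
   or some [a0] in [P] with nonzero coefficient serves as pivot. *)
case: (classic (exists a0 c0, [/\ P a0, (c0 : 'I_n.+1 -> rat) ord0 != 0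
    & Q' (a0 - \sum_i c0 i *: h i)])) => [[a0 [c0 [Pa0 c00 Qa0]]]|no]; last first.
  apply: (IH h') => // a Pa; have [c hc] := hh a Pa.
  exists (fun i => c (lift ord0 i)).
  have c0 : c ord0 = 0 by apply/eqP/negPn/negP => c0; apply: no; exists a, c.
  by move: hc; rewrite big_ord_recl c0 scale0r add0r.
pose P1 a := P a /\ exists c : 'I_n -> rat, Q' (a - \sum_i c i *: h' i).
have hP1 : lin_closed P1.
  split.
    split; first by case: hP.
    exists (fun _ => 0); rewrite big1 ?subr0; first by case: hQ'.
    by move=> i _; rewrite scale0r.
  move=> k a b [Pa [c hc]] [Pb [c' hc']]; split; first by case: hP => _; apply.
  exists (fun i => k * c i + c' i).
  have -> : k *: a + b - \sum_i (k * c i + c' i) *: h' i =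
      k *: (a - \sum_i c i *: h' i) + (b - \sum_i c' i *: h' i).
    under eq_bigr do rewrite scalerDl -scalerA.
    by rewrite big_split /= -scaler_sumr scalerBr opprD addrACA.
  by case: hQ' => _; apply.
have [||m [g [Pg hg]]] := IH h' P1 hP1.
- by move=> a [Pa _]; apply: PQ.
- by move=> a [].
exists m.+1, (fun i => if unlift ord0 i is Some j then g j else a0); split.
  by move=> i; case: unliftP => [j _|_] //; case: (Pg j).
move=> a Pa; have [c hc] := hh a Pa.
pose t := c ord0 / c0 ord0.
have [|c' hc'] := hg (a - t *: a0).
  split; first by apply: lin_closedB => //; apply: lin_closedZ.
  exists (fun i => c (lift ord0 i) - t * c0 (lift ord0 i)).
  have -> : a - t *: a0 - \sum_i (c (lift ord0 i) - t * c0 (lift ord0 i)) *: h' i =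
     (a - \sum_i c i *: h i) - t *: (a0 - \sum_i c0 i *: h i).
    rewrite !big_ord_recl /=; under eq_bigr do rewrite scalerBl -scalerA.
    rewrite sumrB -scaler_sumr scalerBr scalerDr scalerA divfK //.
    set x := \sum_i c _ *: _; set y := \sum_i c0 _ *: _; set z := _ *: h ord0.
    by rewrite !opprB opprD !addrA [RHS](ACl (1*6*5*3*(2*4)))%AC /= addNr addr0.
  by apply: lin_closedB => //; apply: lin_closedZ.
exists (fun i => if unlift ord0 i is Some j then c' j else t).
rewrite big_ord_recl unlift_none opprD addrA.
by under eq_bigr do rewrite liftK.
Qed.

Lemma finite_index_finType P Q (T : finType) (h : T -> A) :
  (forall t, P (h t)) ->
  (forall a, P a -> exists c : T -> rat, Q (a - \sum_t c t *: h t)) -> finite_index P Q.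
Proof.
move=> Ph hQ; exists #|T|, (fun i => h (enum_val i)); split=> // a /hQ [c hc].
exists (fun i => c (enum_val i)).
suff -> : \sum_(i < #|T|) c (enum_val i) *: h (enum_val i) = \sum_t c t *: h t by [].
by rewrite [RHS](reindex (fun i : 'I_#|T| => enum_val i)) //; apply/onW_bij/enum_val_bij.
Qed.

End FiniteIndex.

(** * Quotients by central cocycles [z i] with contractions [b i] and division operators [D i] *)

Section Koszul.
Variables (A : algType rat) (C : A -> Prop) (d : {linear A -> A}) (I : eqType).
Variables (z b : I -> A) (D : I -> A -> A).
Hypotheses (C_lin : lin_closed C) (C_d : forall c, C c -> C (d c))
  (d_d : forall c, d (d c) = 0).
Hypotheses (z_central : forall i x, z i * x = x * z i)
  (d_z : forall i c, d (z i * c) = z i * d c).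
Hypotheses (b_C : forall i c, C c -> C (b i * c))
  (d_b : forall i c, d (b i * c) = z i * c - b i * d c).
Hypotheses (D_lin : forall i, linear (D i)) (D_C : forall i c, C c -> C (D i c))
  (D_z : forall i c, C c -> D i (z i * c) = c)
  (D_z' : forall i j c, i != j -> C c -> D i (z j * c) = z j * D i c).
Implicit Types s : seq I.

Definition zspan s := lin_span (fun y => exists i c, [/\ i \in s, C c & y = z i * c]).
(** With [rel_boundary], representatives in [C] of the cocycles and coboundaries of the complex
    [C / zspan s]. *)
Definition rel_cycle s a := C a /\ zspan s (d a).
Definition rel_boundary s a := exists x e, [/\ C x, zspan s e & a = d x + e].

Lemma zspan_lin s : lin_closed (zspan s).
Proof. exact: lin_span_closed. Qed.

Lemma zspan_d s a : zspan s a -> zspan s (d a).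
Proof.
move: a; apply: lin_span_min; first exact: (lin_closed_preim d (zspan_lin s)).
move=> _ [i [c [si Cc ->]]]; apply: lin_span_in; exists i, (d c).
by split; [| exact: C_d | exact: d_z].
Qed.

Lemma zspan_b s i a : zspan s a -> zspan s (b i * a).
Proof.
move: a; apply: lin_span_min.
  split=> [|k x y hx hy]; first by rewrite mulr0; apply: span_zero.
  by rewrite mulrDr -scalerAr; case: (zspan_lin s) => _; apply.
move=> _ [j [c [sj Cc ->]]]; apply: lin_span_in; exists j, (b i * c).
by split=> //; [apply: b_C | rewrite mulrA -z_central mulrA].
Qed.

Lemma zspan_D s i a : i \notin s -> zspan s a -> zspan s (D i a).
Proof.
move=> si; move: a; apply: lin_span_min.
  split=> [|k x y hx hy]; last by rewrite D_lin; case: (zspan_lin s) => _; apply.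
  have -> : D i 0 = 0; last exact: span_zero.
  by rewrite -[X in D i X](scaler0 _ (-1)) -[X in D i X]addr0 D_lin scaleN1r addNr.
move=> _ [j [c [sj Cc ->]]]; apply: lin_span_in; exists j, (D i c).
split=> //; first exact: D_C.
by apply: D_z' => //; apply: contraNneq si => ->.
Qed.

(** [D i] undoes multiplication by [z i] and, commuting with the other [z j], preserves
    [zspan s]. *)
Lemma zspan_regular s i c : i \notin s -> C c -> zspan s (z i * c) -> zspan s c.
Proof. by move=> si Cc /(zspan_D si); rewrite D_z. Qed.

Lemma zspan_cons s i a : zspan (i :: s) a -> exists c e, [/\ C c, zspan s e & a = z i * c + e].
Proof.
elim=> [|k x y [j [c [sj Cc ->]]] _ [c' [e [Cc' ze ->]]]].
  exists 0, 0; split; [by case: C_lin | exact: span_zero | by rewrite mulr0 addr0].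
move: sj; rewrite in_cons => /orP [/eqP ->|sj].
  exists (k *: c + c'), e; split=> //; first by case: C_lin => _; apply.
  by rewrite mulrDr scalerAr addrA.
exists c', (k *: (z j * c) + e); split=> //; last by rewrite addrCA.
by apply: span_lin => //; exists j, c.
Qed.

Lemma zspan_sub s i a : zspan s a -> zspan (i :: s) a.
Proof.
apply: lin_span_mono => _ [j [c [sj Cc ->]]]; exists j, c; split=> //.
by rewrite in_cons sj orbT.
Qed.

Lemma rel_cycle_lin s : lin_closed (rel_cycle s).
Proof.
split=> [|k x y [Cx zx] [Cy zy]].
  by split; [case: C_lin | rewrite linear0; apply: span_zero].
split; first by case: C_lin => _; apply.
by rewrite linearP; case: (zspan_lin s) => _; apply.
Qed.

Lemma rel_boundary_lin s : lin_closed (rel_boundary s).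
Proof.
split=> [|k x y [x1 [e1 [Cx ze ->]]] [x2 [e2 [Cy ze' ->]]]].
  exists 0, 0; split; [by case: C_lin | exact: span_zero | by rewrite linear0 addr0].
exists (k *: x1 + x2), (k *: e1 + e2); split; first by case: C_lin => _; apply.
  by case: (zspan_lin s) => _; apply.
by rewrite linearP scalerDr addrACA.
Qed.

(* Multiplication by [z i] is injective on [C / zspan s] and null-homotopic through [b i], so the long
   exact sequence embeds the cohomology of [C / zspan s] into that of [C / zspan (i :: s)]. *)
Lemma finite_index_uncons s i : i \notin s ->
  finite_index (rel_cycle (i :: s)) (rel_boundary (i :: s)) ->
  finite_index (rel_cycle s) (rel_boundary s).
Proof.
move=> si; apply: finite_index_sub; try exact: rel_cycle_lin; try exact: rel_boundary_lin.
  by move=> a [Ca za]; split=> //; apply: zspan_sub.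
move=> a [Ca za] [x [e0 [Cx /zspan_cons [c [e [Cc ze ->]]] Ea]]].
have zdc : zspan s (d c).
  apply: (zspan_regular si); first exact: C_d.
  have -> : z i * d c = d a - d e.
    by rewrite Ea !linearD /= d_d add0r d_z addrK.
  by apply: lin_closedB => //; [apply: zspan_lin | apply: zspan_d].
exists (x + b i * c), (b i * d c + e); split.
- by apply: lin_closedD => //; apply: b_C.
- by apply: lin_closedD; [exact: zspan_lin | apply: zspan_b | ].
by rewrite Ea linearD /= d_b -!addrA addKr.
Qed.

(** If [C / zspan s] is finite-dimensional, so is its cohomology. Removing the elements of [s] one
    by one ends at the empty list, where [zspan] is zero and the cohomology is that of [C]. *)
Lemma koszul_finite s : uniq s -> finite_index C (zspan s) ->
  finite_index (rel_cycle [::]) (rel_boundary [::]).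
Proof.
move=> us fs.
have : finite_index (rel_cycle s) (rel_boundary s).
  apply: finite_index_sub fs; try exact: rel_cycle_lin; try exact: rel_boundary_lin.
  - exact: zspan_lin.
  - by move=> a [].
  move=> a _ za; exists 0, a; split=> //; [by case: C_lin | by rewrite linear0 add0r].
elim: s us {fs} => // i s IH /andP [si us] /(finite_index_uncons si).
exact: IH.
Qed.

End Koszul.

(** * Words, subalgebras [Lambda Z] and division by an even generator *)

Section Words.
Variable M : freeCDGA.
Implicit Types Z Y : graded_subspace M.
Local Notation A := (alg M).
Local Notation d := (diff M).
Local Notation iota := (incl M).

Lemma homog_gca : graded_comm_algebra (@homog M).
Proof. by case: (free_alg M). Qed.

Lemma homog_incl k v : homog k (iota k v).
Proof. by case: (free_alg M). Qed.

Lemma incl_central k v x : ~~ odd k -> iota k v * x = x * iota k v.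
Proof. by move=> ek; apply: (even_central homog_gca _ ek); apply: homog_incl. Qed.

Lemma word_homog Z n a : word Z n a -> exists k, homog k a.
Proof.
elim=> [|k v m b _ _ [q hb]]; first by exists 0%N; apply: gca_one homog_gca.
by exists (k + q)%N; apply: (gca_mul homog_gca) => //; apply: homog_incl.
Qed.

Lemma word_cat Z n m a b : word Z n a -> word Z m b -> word Z (n + m) (a * b).
Proof.
move=> wa wb; elim: wa => [|k v n' a' vZ _ IH]; first by rewrite mul1r.
by rewrite -mulrA; apply: word_cons.
Qed.

Lemma word_sub Z Y n a : (forall k, (Z k <= Y k)%VS) -> word Z n a -> word Y n a.
Proof.
move=> ZY; elim=> [|k v m b vZ _ IH]; first exact: word_nil.
by apply: word_cons => //; apply: (subvP (ZY k)).
Qed.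

Lemma Lambda_lin Z : lin_closed (Lambda Z).
Proof. exact: lin_span_closed. Qed.

Lemma Lambda_sub Z Y a : (forall k, (Z k <= Y k)%VS) -> Lambda Z a -> Lambda Y a.
Proof. by move=> ZY; apply: lin_span_mono => x [n /(word_sub ZY) h]; exists n. Qed.

Lemma Lambda1 Z : Lambda Z 1.
Proof. by apply: lin_span_in; exists 0%N; apply: word_nil. Qed.

Lemma Lambda_incl Z k v : v \in Z k -> Lambda Z (iota k v).
Proof.
move=> vZ; apply: lin_span_in; exists 1%N; rewrite -[iota k v]mulr1.
by apply: word_cons => //; apply: word_nil.
Qed.

Lemma Lambda_mul Z a b : Lambda Z a -> Lambda Z b -> Lambda Z (a * b).
Proof.
move=> ha hb; move: a ha; apply: lin_span_min.
  split=> [|k x y hx hy]; first by rewrite mul0r; apply: span_zero.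
  by rewrite mulrDl -scalerAl; case: (Lambda_lin Z) => _; apply.
move=> a [n wa]; move: b hb; apply: lin_span_min.
  split=> [|k x y hx hy]; first by rewrite mulr0; apply: span_zero.
  by rewrite mulrDr -scalerAr; case: (Lambda_lin Z) => _; apply.
by move=> b [m wb]; apply: lin_span_in; exists (n + m)%N; apply: word_cat.
Qed.

Lemma LambdaX Z a N : Lambda Z a -> Lambda Z (a ^+ N).
Proof.
by move=> ha; elim: N => [|N IH]; rewrite ?exprS; [exact: Lambda1 | exact: Lambda_mul].
Qed.

Lemma Lambda_ind Z (P : A -> Prop) : lin_closed P -> P 1 ->
  (forall k v a, v \in Z k -> Lambda Z a -> P a -> P (iota k v * a)) ->
  forall a, Lambda Z a -> P a.
Proof.
move=> hP P1 PM; apply: lin_span_min => // a [n]; elim=> // k v m b vZ wb IH.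
by apply: PM => //; apply: lin_span_in; exists m.
Qed.

Lemma diff_incl_mul k v a : d (iota k v * a) = d (iota k v) * a + (-1 : rat) ^+ k *: (iota k v * d a).
Proof. by apply: diff_leibniz; apply: homog_incl. Qed.

Lemma diff1 : d 1 = 0.
Proof.
have := diff_leibniz 1 (gca_one homog_gca).
rewrite expr0 scale1r !mulr1 mul1r => /eqP.
by rewrite -[X in X == _]addr0 (inj_eq (addrI _)) eq_sym => /eqP.
Qed.

Lemma Lambda_diff Z a : d_maps Z (Lambda Z) -> Lambda Z a -> Lambda Z (d a).
Proof.
move=> dZ; move: a; apply: Lambda_ind.
- exact: (lin_closed_preim (diff M) (Lambda_lin Z)).
- by rewrite diff1; apply: span_zero.
move=> k v a vZ la IH; rewrite diff_incl_mul.
apply: lin_closedD; first exact: Lambda_lin.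
  by apply: Lambda_mul => //; apply: dZ.
by apply: lin_closedZ; [exact: Lambda_lin | apply: Lambda_mul => //; apply: Lambda_incl].
Qed.

Lemma even_word Z n a : word (sub_even Z) n a -> exists k, ~~ odd k /\ homog k a.
Proof.
elim=> [|k v m b vZ _ [q [eq hb]]]; first by exists 0%N; split=> //; apply: gca_one homog_gca.
move: vZ; rewrite /sub_even; case: ifP => ok vZ.
  exists 0%N; split=> //; move: vZ; rewrite memv0 => /eqP ->.
  by rewrite linear0 mul0r; apply: gca_zero homog_gca _.
exists (k + q)%N; rewrite oddD ok (negbTE eq); split=> //.
by apply: (gca_mul homog_gca) => //; apply: homog_incl.
Qed.

Lemma Lambda_even_central Z a x : Lambda (sub_even Z) a -> a * x = x * a.
Proof.
move: a; apply: lin_span_min.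
  split=> [|k u y hx hy]; first by rewrite mulr0 mul0r.
  by rewrite mulrDl mulrDr -scalerAl -scalerAr hx hy.
by move=> a [n /even_word [k [ek ha]]]; apply: (even_central homog_gca _ ek ha).
Qed.

Lemma Lambda_even_comm_sub Z : comm_sub (Lambda (sub_even Z)).
Proof.
split; [exact: Lambda_lin | exact: Lambda1 | by move=> *; apply: Lambda_mul|].
by move=> a b ha _; apply: (Lambda_even_central _ ha).
Qed.

(* The morphism [A -> A[X]] sending the generator [x] to ['X] and fixing the kernel of [T] and all
   other generators lets one divide by [x]. *)
Lemma division_operator e (x : gens M e) (T : {linear gens M e -> rat^o}) :
  ~~ odd e -> T x = 1 -> exists D : A -> A,
  [/\ linear D, D 1 = 0,
      forall v a, Lambda (sub_full M) a ->
        D (iota e v * a) = T v *: a + iota e (v - T v *: x) * D a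
    & forall k v a, e != k -> Lambda (sub_full M) a -> D (iota k v * a) = iota k v * D a].
Proof.
move=> ee Tx; pose PA := polyalg A.
have gcaP := polyalg_gca homog_gca ee.
pose g0 k (v : gens M k) : PA := (iota k v)%:P.
have g0_lin k : linear (@g0 k).
  move=> c u v; rewrite /g0 linearP /= polyCD; congr (_ + _).
  by apply/(@polyP A) => i; rewrite coef_polyalg_scale !coefC; case: ifP; rewrite ?scaler0.
pose g k : {linear gens M k -> PA} := HB.pack (@g0 k) (GRing.isLinear.Build _ _ _ _ (@g0 k) (g0_lin k)).
pose f0 (v : gens M e) : PA := (T v : rat) *: ('X : PA) + g e (v - T v *: x).
have f0_lin : linear f0.
  move=> c u v; rewrite /f0 (linearP T).
  have -> : c *: u + v - (c *: T u + T v) *: x = c *: (u - T u *: x) + (v - T v *: x).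
    by rewrite scalerBr scalerDl opprD addrACA scalerA.
  rewrite (linearP (g e)) scalerDl -scalerA scalerDr addrACA.
  by congr (_ + _).
pose f : {linear gens M e -> PA} := HB.pack f0 (GRing.isLinear.Build _ _ _ _ f0 f0_lin).
have hom k v : polyalg_homog (@homog M) e k (override g f k v).
  have z k' : homog k' (0 : A) by apply: gca_zero homog_gca _.
  have hC k' w : polyalg_homog (@homog M) e k' ((iota k' w)%:P : PA).
    move=> i; rewrite coefC; case: eqP => [->|_]; last by case: ifP => // _; apply: z.
    by rewrite muln0 subn0; apply: homog_incl.
  have [E|ne] := eqVneq e k; last by rewrite override_neq //; apply: hC.
  case: k / E v => v; rewrite override_eq => i.
  rewrite /= /f0 (@coefD A) coef_polyalg_scale coefX; move: (hC e (v - T v *: x) i).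
  case: eqP => [->|_]; last by rewrite scaler0 add0r.
  rewrite muln1 leqnn subnn /g0 coefC /= addr0 => _.
  by apply: lin_closedZ; [exact: homog_closed homog_gca _ | exact: gca_one homog_gca].
have [_ _ univ] := free_alg M.
have [Phi [_ Phi_incl _]] := univ PA _ _ gcaP hom.
pose ev (p : PA) : A := (p : {poly A}).[iota e x].
have ev_lin : linear ev.
  by move=> c p q; rewrite /ev (@hornerD A) [X in X + _](@hornerZ A) -scalerAl mul1r.
have evX p : ev (('X : {poly A}) * (p : {poly A})) = iota e x * ev p.
  by rewrite /ev -commr_polyX hornerMX incl_central.
have evC c p : ev (c%:P * (p : {poly A})) = c * ev p by rewrite /ev hornerCM.
have Phi_x v a : Phi (iota e v * a) =
    T v *: (('X : {poly A}) * (Phi a : {poly A}) : PA) + (iota e (v - T v *: x))%:P * Phi a.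
  by rewrite rmorphM /= Phi_incl override_eq /f /= /f0 mulrDl -scalerAl.
have Phi_other k v a : e != k -> Phi (iota k v * a) = (iota k v)%:P * Phi a.
  by move=> ne; rewrite rmorphM /= Phi_incl override_neq.
have ev_Phi a : Lambda (sub_full M) a -> ev (Phi a) = a.
  move: a; apply: Lambda_ind.
  - split=> [|c a b ha hb]; first by rewrite linear0 /ev horner0.
    by rewrite linearP ev_lin ha hb.
  - by rewrite rmorph1 /ev hornerC.
  move=> k v a _ _ IH; have [E|ne] := eqVneq e k; last by rewrite Phi_other // evC IH.
  case: k / E v => v; rewrite Phi_x ev_lin evX evC IH linearB linearZ mulrBl /=.
  by rewrite -scalerAl addrCA subrr addr0.
(* Dropping the constant coefficient and lowering the exponents divides by ['X]; evaluation at the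
   generator then returns to [A]. *)
pose D a := ev (drop_poly 1 (Phi a : {poly A})).
have dropX (p : {poly A}) : drop_poly 1 ('X * p) = p.
  by apply/polyP => i; rewrite coef_drop_poly addn1 coefXM.
have dropC c (p : {poly A}) : drop_poly 1 (c%:P * p) = c%:P * drop_poly 1 p.
  by apply/polyP => i; rewrite coefCM !coef_drop_poly coefCM.
have drop_lin (c : rat) (p q : PA) : drop_poly 1 (c *: p + q : {poly A}) =
    c *: (drop_poly 1 (p : {poly A}) : PA) + (drop_poly 1 (q : {poly A}) : PA) :> PA.
  apply/(@polyP A) => i; rewrite [RHS](@coefD A) coef_polyalg_scale !coef_drop_poly.
  by rewrite (@coefD A) coef_polyalg_scale.
exists D; split.
- by move=> c a b; rewrite /D linearP drop_lin ev_lin.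
- rewrite /D rmorph1 drop_poly_eq0 ?size_poly1 // /ev; exact: horner0.
- by move=> v a /ev_Phi ha; rewrite /D Phi_x drop_lin dropX dropC ev_lin evC ha.
by move=> k v a ne _; rewrite /D Phi_other // dropC evC.
Qed.

End Words.

(** * Basis letters of [Z] and the finiteness criterion for its cohomology *)

Section Letters.
Variables (M : freeCDGA) (Z : graded_subspace M) (N0 : nat).
Hypothesis Z_vanishes : vanishes_from Z N0.
Local Notation A := (alg M).
Local Notation d := (diff M).
Local Notation iota := (incl M).

Definition gen_index : finType := {k : 'I_N0 & 'I_(\dim (Z k))}.
Implicit Types (t : gen_index) (s : seq gen_index).

Definition letter_vec t : gens M (tag t) := (vbasis (Z (tag t)))`_(tagged t).
Definition letter t : A := iota (tag t) (letter_vec t).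
Definition letter_prod s : A := foldr (fun t a => letter t * a) 1 s.

Lemma letter_vec_in t : letter_vec t \in Z (tag t).
Proof. by apply/vbasis_mem/mem_nth; rewrite size_tuple. Qed.

Lemma homog_letter t : homog (tag t) (letter t).
Proof. exact: homog_incl. Qed.

Lemma Lambda_letter t : Lambda Z (letter t).
Proof. exact: Lambda_incl (letter_vec_in t). Qed.

Lemma Lambda_letter_prod s : Lambda Z (letter_prod s).
Proof.
by elim: s => [|t s IH]; [exact: Lambda1 | apply: Lambda_mul IH; exact: Lambda_letter].
Qed.

Lemma Lambda_span_letter_prod a : Lambda Z a -> lin_span (fun x => exists s, x = letter_prod s) a.
Proof.
move: a; apply: Lambda_ind; first exact: lin_span_closed.
  by apply: lin_span_in; exists [::].
move=> k v a vZ _ IH; have [lt|le] := ltnP k N0; last first.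
  move: vZ; rewrite (Z_vanishes le) memv0 => /eqP ->.
  by rewrite linear0 mul0r; apply: span_zero.
rewrite (coord_vbasis vZ) linear_sum /= mulr_suml.
apply: lin_closed_sum; first exact: lin_span_closed.
move=> i _; rewrite linearZ -scalerAl; apply: lin_closedZ; first exact: lin_span_closed.
pose t : gen_index := existT (fun k : 'I_N0 => 'I_(\dim (Z k))) (Ordinal lt) i.
move: a IH; apply: (@lin_span_min A _ (fun a => lin_span _ (letter t * a))).
  split=> [|c x y hx hy]; first by rewrite mulr0; apply: span_zero.
  by rewrite mulrDr -scalerAr; case: (lin_span_closed (fun x : A => exists s, x = letter_prod s)) => _; apply.
by move=> _ [s ->]; apply: lin_span_in; exists (t :: s).
Qed.

Lemma letter_prod_rem t s : t \in s ->
  exists c : rat, letter_prod s = c *: (letter t * letter_prod (rem t s)).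
Proof.
elim: s => //= t' s IH; rewrite in_cons; case: eqVneq => [->|ne] /=.
  by exists 1; rewrite scale1r.
move=> /IH [c ->].
exists (c * (-1) ^+ (tag t' * tag t)).
rewrite -scalerAr (mulrA (letter t')) (gca_comm (homog_gca M) (homog_letter t') (homog_letter t)).
by rewrite -scalerAl scalerA -mulrA.
Qed.

Lemma letter_prod_count t s N : (N <= count_mem t s)%N ->
  exists (c : rat) s', letter_prod s = c *: (letter t ^+ N * letter_prod s').
Proof.
elim: N s => [|N IH] s h; first by exists 1, s; rewrite expr0 mul1r scale1r.
have ts : t \in s by rewrite -has_pred1 has_count (leq_trans _ h).
have [c ->] := letter_prod_rem ts.
have [|c' [s' ->]] := IH (rem t s).
  by rewrite -ltnS (leq_trans h) // (permP (perm_to_rem ts)) /= eqxx.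
by exists (c * c'), s'; rewrite -scalerAr scalerA mulrA -exprS.
Qed.

Lemma pigeonhole (N : gen_index -> nat) s : (\sum_t N t < size s)%N ->
  exists t, (N t <= count_mem t s)%N.
Proof.
move=> lt; apply/existsP; apply: contraLR lt => /existsPn h; rewrite -leqNgt.
have -> : size s = (\sum_t count_mem t s)%N.
  elim: (s) => [|t s' IH] /=; first by rewrite big1.
  rewrite big_split /= -IH (bigD1 t) //= eqxx big1 ?addn0 // => t' ne.
  by rewrite eq_sym (negbTE ne).
by apply: leq_sum => t _; apply: ltnW; rewrite ltnNge.
Qed.

(** [T] is the coordinate functional dual to [t]. It kills the other basis letters of the same
    degree, so the division operator passes over them too. *)
Lemma letter_division t : ~~ odd (tag t) -> exists D : A -> A,
  [/\ linear D, forall a, Lambda Z a -> Lambda Z (D a),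
      forall a, Lambda Z a -> D (letter t * a) = a
    & forall t' a, t' != t -> Lambda Z a -> D (letter t' * a) = letter t' * D a].
Proof.
move=> et; pose T : {linear gens M (tag t) -> rat^o} := coord (vbasis (Z (tag t))) (tagged t).
have coordT i : coord (vbasis (Z (tag t))) (tagged t) (vbasis (Z (tag t)))`_i
    = (tagged t == i :> nat)%:R.
  have [lt|le] := ltnP i (\dim (Z (tag t))).
    by rewrite (coord_free (Ordinal lt)) ?(basis_free (vbasisP _)) // eq_sym.
  rewrite nth_default ?size_tuple // linear0; case: eqP => // E.
  by move: (ltn_ord (tagged t)); rewrite E ltnNge le.
have Tx : T (letter_vec t) = 1 by apply: etrans (coordT _) _; rewrite eqxx.
have [D [D_lin D1 D_x D_other]] := division_operator (T := T) et Tx.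
have full a : Lambda Z a -> Lambda (sub_full M) a by apply: Lambda_sub => k; apply: subvf.
have D0 : D 0 = 0 by rewrite -[X in D X](scaler0 _ (-1)) -[X in D X]addr0 D_lin scaleN1r addNr.
exists D; split=> //.
- apply: Lambda_ind.
  + split=> [|c x y hx hy]; first by rewrite D0; apply: span_zero.
    by rewrite D_lin; case: (Lambda_lin Z) => _; apply.
  + by rewrite D1; apply: span_zero.
  move=> k v a vZ la IH; have [E|ne] := eqVneq (tag t : nat) k; last first.
    by rewrite (D_other _ _ _ ne (full _ la)); apply: Lambda_mul => //; apply: Lambda_incl.
  case: k / E v vZ => v vZ; rewrite (D_x _ _ (full _ la)); apply: lin_closedD; first exact: Lambda_lin.
    by apply: lin_closedZ => //; apply: Lambda_lin.
  apply: Lambda_mul => //; apply: Lambda_incl; apply: rpredB => //.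
  by apply: rpredZ; apply: letter_vec_in.
- by move=> a la; rewrite (D_x (letter_vec t) _ (full _ la)) Tx !scale1r subrr linear0 mul0r addr0.
move=> t' a ne la; have [E|ne'] := eqVneq (tag t : nat) (tag t'); last first.
  by rewrite (D_other _ _ _ ne' (full _ la)).
move: E => /val_inj E; rewrite /letter; case: t' E ne => k i /= E.
case: k / E i => i ne; rewrite (D_x _ _ (full _ la)) /letter_vec /= /T coordT.
have -> : (tagged t == i :> nat) = false.
  apply/negbTE; apply: contraNneq ne => /val_inj <-.
  by case: (t).
by rewrite !scale0r subr0 add0r.
Qed.

Lemma letter_power_division t N : ~~ odd (tag t) -> exists D : A -> A,
  [/\ linear D, forall a, Lambda Z a -> Lambda Z (D a),
      forall a, Lambda Z a -> D (letter t ^+ N * a) = a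
    & forall t' n a, t' != t -> Lambda Z a -> D (letter t' ^+ n * a) = letter t' ^+ n * D a].
Proof.
move=> et; have [D [D_lin D_C D_t D_t']] := letter_division et.
have LX t' n a : Lambda Z a -> Lambda Z (letter t' ^+ n * a).
  by move=> la; apply: Lambda_mul => //; apply: LambdaX; apply: Lambda_letter.
have D_pow t' n a : t' != t -> Lambda Z a -> D (letter t' ^+ n * a) = letter t' ^+ n * D a.
  move=> ne la; elim: n => [|n IH]; first by rewrite !mul1r.
  by rewrite !exprS -!mulrA D_t' ?IH //; apply: LX.
have iter_C n a : Lambda Z a -> Lambda Z (iter n D a).
  by move=> la; elim: n => //= n IH; apply: D_C.
exists (iter N D); split.
- by elim: N => [|N IH] c x y //=; rewrite IH D_lin.
- exact: iter_C.
- move=> a la; elim: N => [|N IH]; first by rewrite mul1r.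
  by rewrite iterSr exprS -mulrA D_t ?IH //; apply: LX.
move=> t' n a ne la; elim: N => //= N IH.
by rewrite IH D_pow //; apply: iter_C.
Qed.

Hypotheses (Z_diff : d_maps Z (Lambda Z))
  (Z_even : forall k v, ~~ odd k -> v \in Z k -> d (iota k v) = 0)
  (Z_nil : forall k v, ~~ odd k -> v \in Z k ->
     exists N b, Lambda Z b /\ d b = iota k v ^+ N).

(** Only the component of [b] in the degree just below [x] contributes to [d b = x]. Its odd degree
    produces the sign in [d (b c) = x c - b d c] on which the contraction relies. *)
Lemma odd_primitive k (x : A) b : ~~ odd k -> homog k x -> Lambda Z b -> d b = x ->
  exists b' p, [/\ Lambda Z b', odd p, homog p b' & d b' = x].
Proof.
move=> ek hx lb db.
have hS a : (exists n, word Z n a) -> exists k, homog k a by case=> n /word_homog.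
have [N [c [h1 h2 Eb]]] := lin_span_homog hS lb.
have hc j : homog j (c j).
  by apply: lin_span_min (h1 j) => [|a []] //; apply: homog_closed (homog_gca M) _.
have lc j : Lambda Z (c j) by apply: lin_span_mono (h1 j) => a [].
(* [d] raises degrees by one, so the component of [d b] in degree [j.+1] is [d (c j)]. *)
pose c' j := if j is j'.+1 then d (c j') else 0.
have hc' j : homog j (c' j).
  case: j => [|j] /=; first exact: gca_zero (homog_gca M) _.
  exact: diff_deg.
have Ex : x = \sum_(j < N.+1) c' j.
  by rewrite big_ord_recl /= add0r -db Eb linear_sum.
have {Ex} -> : x = if (k < N.+1)%N then c' k else 0.
  by rewrite [LHS]Ex; apply: (homog_component (homog_gca M) hc'); rewrite -Ex.
(* When no component is available [x] is zero, and 0 is homogeneous of the odd degree 1. *)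
case: ifP => [lt|_]; last first.
  exists 0, 1%N; split=> //; [exact: span_zero | exact: gca_zero (homog_gca M) _ | exact: linear0].
case: k ek {hx lt} => [|k] ek /=.
  exists 0, 1%N; split=> //; [exact: span_zero | exact: gca_zero (homog_gca M) _ | exact: linear0].
by exists (c k), k; split=> //; move: ek; rewrite /= negbK.
Qed.

Definition even_gen_index : finType := {t : gen_index | ~~ odd (tag t)}.

Lemma diff_letterX (t : even_gen_index) N c :
  d (letter (val t) ^+ N * c) = letter (val t) ^+ N * d c.
Proof.
elim: N => [|N IH]; first by rewrite !mul1r.
rewrite exprS -!mulrA diff_incl_mul Z_even ?(valP t) ?letter_vec_in // mul0r add0r IH.
by rewrite -signr_odd (negbTE (valP t)) expr0 scale1r.
Qed.

Lemma finite_cohomology : finite_dim_cohomology Z.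
Proof.
have /fin_all_exists [N /fin_all_exists [b /fin_all_exists [p hb]]] (t : even_gen_index) :
    exists N b p, [/\ Lambda Z b, odd p, homog p b & d b = letter (val t) ^+ N].
  have [N [b [lb db]]] := Z_nil (valP t) (letter_vec_in (val t)).
  exists N; apply: (odd_primitive _ _ lb db (k := (tag (val t) * N)%N)).
    by rewrite oddM (negbTE (valP t)).
  by apply: (homogX (homog_gca M)); apply: homog_letter.
have /fin_all_exists [D hD] := fun u : even_gen_index => letter_power_division (N u) (valP u).
pose z (u : even_gen_index) := letter (val u) ^+ N u.
have z_central (t : even_gen_index) x : z t * x = x * z t.
  apply: (even_central (homog_gca M) _ (p := (tag (val t) * N t)%N)).
    by rewrite oddM (negbTE (valP t)).
  by apply: (homogX (homog_gca M)); apply: homog_letter.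
have finC : finite_index (Lambda Z) (zspan (Lambda Z) z (enum even_gen_index)).
  (* A word longer than the sum of the [N' t] repeats some letter [N' t] times: an even letter then
     gives a multiple of [z], and an odd one gives zero because it squares to zero. *)
  pose N' (t : gen_index) := if (insub t : option even_gen_index) is Some t' then N t' else 2%N.
  pose L := (\sum_t N' t)%N.
  pose W := {: L.-bseq gen_index}.
  have key a : Lambda Z a -> exists c : W -> rat,
      zspan (Lambda Z) z (enum even_gen_index) (a - \sum_w c w *: letter_prod w).
    move=> /Lambda_span_letter_prod; elim=> [|k x y [s ->] _ [c IH]].
      exists (fun _ => 0); rewrite big1 ?subr0; first exact: span_zero.
      by move=> w _; rewrite scale0r.
    have [le|lt] := leqP (size s) L.
      exists (fun w => k * (w == Bseq le)%:R + c w).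
      have -> : \sum_w (k * (w == Bseq le)%:R + c w) *: letter_prod w =
          k *: letter_prod s + \sum_w c w *: letter_prod w.
        under eq_bigr do rewrite scalerDl; rewrite big_split /=; congr (_ + _).
        rewrite (bigD1 (Bseq le)) //= eqxx mulr1 big1 ?addr0 // => w /negbTE ->.
        by rewrite mulr0 scale0r.
      by rewrite opprD addrACA subrr add0r.
    exists c; have [t ht] := pigeonhole lt.
    rewrite -addrA; move: ht; rewrite /N'; case: insubP => [u ou <-|ot] ht.
      have [q [s' ->]] := letter_prod_count ht.
      apply: span_lin => //; exists u, (q *: letter_prod s'); split; first by rewrite mem_enum.
        by apply: lin_closedZ; [exact: Lambda_lin | exact: Lambda_letter_prod].
      by rewrite scalerAr.
    have [q [s' ->]] := letter_prod_count ht; rewrite negbK in ot.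
    by rewrite expr2 (odd_square (homog_gca M) ot (homog_letter t)) mul0r !scaler0 add0r.
  apply: (finite_index_finType (h := fun w : W => letter_prod w)) => // w.
  exact: Lambda_letter_prod.
have [n [h [hh hh']]] : finite_index (rel_cycle (Lambda Z) (diff M) z [::])
    (rel_boundary (Lambda Z) (diff M) z [::]).
  apply: (koszul_finite (b := b) (D := D)) finC => //.
  - exact: Lambda_lin.
  - by move=> c; apply: Lambda_diff.
  - exact: diff_diff.
  - by move=> t c; apply: diff_letterX.
  - by move=> t c lc; apply: Lambda_mul => //; case: (hb t).
  - move=> t c; have [_ op hom_b db] := hb t.
    by rewrite (diff_leibniz _ hom_b) db -signr_odd op expr1 scaleN1r.
  - by move=> t; case: (hD t).
  - by move=> t; case: (hD t).
  - by move=> t c lc; case: (hD t) => _ _ h _; apply: h.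
  - by move=> t t' c ne lc; case: (hD t) => _ _ _ h; apply: h => //; rewrite val_eqE eq_sym.
  exact: enum_uniq.
have zspan0 x : zspan (Lambda Z) z [::] x -> x = 0.
  by move: x; apply: lin_span_min => [|x [? [? []]]] //; split=> // c x y -> ->; rewrite scaler0 addr0.
exists n, h; split=> [i|a la da].
  by have [lh /zspan0] := hh i.
have [|c [x [e [lx /zspan0 -> E]]]] := hh' a.
  by split=> //; rewrite da; apply: span_zero.
by exists c, x; split=> //; rewrite addrC; apply/eqP; rewrite -subr_eq E addr0.
Qed.

End Letters.

(** * Blocks of even generators of equal degree *)

Section MpolyGraded.
Import mpoly.
Variables (n e : nat).
Hypothesis even_e : ~~ odd e.

(** Every variable has degree [e]. For even [e] the polynomial ring is graded-commutative, hence a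
    target for the universal property of [Lambda V]. *)
Definition mpoly_homog (k : nat) (p : {mpoly rat[n]}) := forall m, p@_m != 0 -> (e * mdeg m)%N = k.

Lemma mpoly_gca : graded_comm_algebra mpoly_homog.
Proof.
have zero k : mpoly_homog k 0 by move=> m; rewrite mcoeff0 eqxx.
have lin k c p q : mpoly_homog k p -> mpoly_homog k q -> mpoly_homog k (c *: p + q).
  move=> hp hq m; rewrite mcoeffD mcoeffZ.
  have [E|/hp //] := eqVneq (p@_m) 0.
  by rewrite E mulr0 add0r; apply: hq.
have closed k : lin_closed (mpoly_homog k) by split=> [|c a b]; [exact: zero | exact: lin].
have homX m : mpoly_homog (e * mdeg m) 'X_[m].
  by move=> m'; rewrite mcoeffX; case: (m =P m') => [->|_] //; rewrite eqxx.
split=> //.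
- by move=> m; rewrite mcoeff1; case: (m =P _) => [->|_]; rewrite ?eqxx // mdeg0 muln0.
- move=> k k' p q hp hq m; rewrite -mcoeff_msupp => /msuppM_le /allpairsP [[m1 m2] [/=]].
  by rewrite !mcoeff_msupp => /hp <- /hq <- ->; rewrite mdegD mulnDr.
- move=> p.
  have: lin_span (fun x => exists k, mpoly_homog k x) p.
    rewrite (mpolyE p); apply: lin_closed_sum; first exact: lin_span_closed.
    move=> m _; apply: lin_closedZ; first exact: lin_span_closed.
    by apply: lin_span_in; exists (e * mdeg m)%N.
  move=> /lin_span_homog h; case: (h mpoly_homog) => // N [c [h1 h2 ->]].
  by exists N, c; split=> // k; apply: lin_span_min (h1 k) => [|x []].
- move=> N c hc h0 k lt; apply/mpolyP => m; rewrite mcoeff0; apply/eqP/negPn/negP => nz.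
  have /eqP := congr1 (mcoeff m) h0; rewrite mcoeff0 raddf_sum (bigD1 (Ordinal lt)) //=.
  rewrite big1 ?addr0; first exact/negP.
  move=> j ne; apply/eqP/negPn/negP => nz'; case/eqP: ne; apply: val_inj.
  by rewrite /= -(hc _ _ nz) -(hc _ _ nz').
move=> k k' p q hp hq; have [-> | nzp] := eqVneq p 0; first by rewrite mul0r mulr0 scaler0.
have <- := hp (mlead p); last by rewrite mleadc_eq0.
by rewrite -signr_odd !oddM (negbTE even_e) /= expr0 scale1r mulrC.
Qed.

End MpolyGraded.

(** * The even part of a pure model *)

Section EvenPart.
Variable M : freeCDGA.
Local Notation A := (alg M).
Local Notation d := (diff M).
Local Notation iota := (incl M).
Local Notation E := (sub_even (sub_full M)).

Lemma even_mem k v : ~~ odd k -> v \in E k.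
Proof. by move=> /negbTE ek; rewrite /sub_even ek memvf. Qed.

Lemma even_mem_odd k v : odd k -> v \in E k -> v = 0.
Proof. by rewrite /sub_even => -> /[!memv0] /eqP. Qed.

Lemma homog_unique D D' (x : A) : homog D x -> homog D' x -> D != D' -> x = 0.
Proof.
move=> hx hx' ne; pose c k := if k == D then x else 0.
have hc k : homog k (c k).
  by rewrite /c; case: eqP => [->|_] //; apply: gca_zero (homog_gca M) _.
have Ex : x = \sum_(k < D.+1) c k.
  rewrite (bigD1 ord_max) //= /c eqxx big1 ?addr0 // => j.
  by rewrite -val_eqE /= => /negbTE ->.
have := homog_component (homog_gca M) hc (N := D.+1) (D := D'); rewrite -Ex => /(_ hx') ->.
by rewrite /c [D' == D]eq_sym (negbTE ne) if_same.
Qed.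

(* The morphism killing the odd generators is the identity on the even part. *)
Lemma even_words (Q : nat -> Prop) (R : A -> Prop) u : Lambda E u ->
  lin_span (fun x => exists n, [/\ Q n, word (sub_full M) n x & R x]) u ->
  lin_span (fun x => exists n, [/\ Q n, word E n x & R x]) u.
Proof.
pose f k : {linear gens M k -> A} := if odd k then (\0 : {linear gens M k -> A}) else iota k.
have hf k v : homog k (f k v).
  rewrite /f; case: ifP => _; last exact: homog_incl.
  exact: gca_zero (homog_gca M) _.
have [_ _ univ] := free_alg M.
have [theta [_ theta_incl _]] := univ A _ _ (homog_gca M) hf.
have theta_id a : Lambda E a -> theta a = a.
  move: a; apply: Lambda_ind.
  - split=> [|c a b ha hb]; first by rewrite linear0.
    by rewrite linearP /= ha hb.
  - exact: rmorph1.
  move=> k v a vE _ IH; rewrite rmorphM /= IH theta_incl /f.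
  case: ifP => // ok; by rewrite (even_mem_odd ok vE) !linear0.
have theta_word n x : word (sub_full M) n x -> theta x = 0 \/ (theta x = x /\ word E n x).
  elim=> [|k v m a _ _ [IH|[IH wa]]].
  - by right; rewrite rmorph1; split=> //; apply: word_nil.
  - by left; rewrite rmorphM /= IH mulr0.
  rewrite rmorphM /= IH theta_incl /f; case: ifP => ok; first by left; rewrite mul0r.
  by right; split=> //; apply: word_cons => //; apply: even_mem; rewrite ok.
move=> /theta_id {2}<-; move: u.
apply: lin_span_min; first exact: (lin_closed_preim theta (@lin_span_closed A _)).
move=> x [n [Qn wx Rx]]; case: (theta_word _ _ wx) => [->|[-> wE]]; first exact: span_zero.
by apply: lin_span_in; exists n.
Qed.

Hypothesis M_pure : pure (sub_full M).

Lemma diff_even_incl k v : ~~ odd k -> d (iota k v) = 0.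
Proof. by move=> /negbTE ek; have := M_pure (memvf v); rewrite ek. Qed.

Lemma diff_odd_incl k v : odd k -> Lambda E (d (iota k v)).
Proof. by move=> ok; have := M_pure (memvf v); rewrite ok. Qed.

(** By purity the even generators are cocycles of even degree, so [d] is linear over the even
    part. *)
Lemma diff_even_mul c b : Lambda E c -> d (c * b) = c * d b.
Proof.
move: c; apply: Lambda_ind.
- split=> [|k x y hx hy]; first by rewrite !mul0r linear0.
  by rewrite !mulrDl -!scalerAl linearP hx hy.
- by rewrite !mul1r.
move=> k v c vE _ IH; have [ok|ek] := boolP (odd k).
  by rewrite (even_mem_odd ok vE) linear0 !mul0r linear0.
by rewrite -mulrA diff_incl_mul diff_even_incl // mul0r add0r IH -signr_odd (negbTE ek) scale1r mulrA.
Qed.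

End EvenPart.

Section Block.
Import mpoly.
Variable M : freeCDGA.
Local Notation A := (alg M).
Local Notation d := (diff M).
Local Notation iota := (incl M).
Local Notation E := (sub_even (sub_full M)).
Variables (l a k : nat).
Hypotheses (M_pure : pure (sub_full M)) (M_fin : finite_dim_cohomology (sub_full M)).
Hypotheses (M_len : d_maps (sub_full M) (Lambda_pow (sub_full M) l)).
Hypotheses (even_a : ~~ odd a) (k_eq : k.+1 = (l * a)%N).

Definition low_even (s : A) := exists b (w : gens M b), [/\ (b < a)%N, ~~ odd b & s = iota b w].

(** The lower even generators are included because the differentials of [U] agree with their
    restrictions to [V^a] only modulo these. *)
Definition block_gens (U : {vspace gens M k}) (s : A) :=
  (exists2 u, u \in U & s = d (iota k u)) \/ low_even s.

Local Notation Va := (fullv : {vspace gens M a}).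
Local Notation n := (\dim Va).
Local Notation P := {mpoly rat[n]}.
Local Notation x i := (iota a (vbasis Va)`_i).

(** The morphism [pi] carries finiteness of cohomology to the polynomial ring on [V^a], where
    [regular_subspace] selects [U]. The morphism [sigma] carries the nilpotency of the variables
    back. *)
Lemma block_subspace : exists U : {vspace gens M k}, \dim U = n /\
  forall i : 'I_n, exists N, gen_ideal (Lambda E) (block_gens U) (x i ^+ N).
Proof.
have odd_k : odd k.
  by have := congr1 odd k_eq; rewrite /= oddM (negbTE even_a) andbF => /negbFE.
have a0 : (0 < a)%N by case: (a) k_eq => //; rewrite muln0.
have l0 : (0 < l)%N by case: (l) k_eq.
pose chi0 (v : gens M a) : P := \sum_i coord (vbasis Va) i v *: 'X_i.
have chi_lin : linear chi0.
  move=> c u v; rewrite /chi0 scaler_sumr -big_split; apply: eq_bigr => i _ /=.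
  by rewrite linearP scalerDl scalerA.
pose chi : {linear gens M a -> P} := HB.pack chi0 (GRing.isLinear.Build _ _ _ _ chi0 chi_lin).
pose g j : {linear gens M j -> P} := override (fun k => \0 : {linear gens M k -> P}) chi j.
have chi_homog v : chi0 v \is 1.-homog.
  by apply: rpred_sum => i _; apply: rpredZ; rewrite dhomogX; apply/eqP; apply: mdeg1.
have g_homog j v : g j v \is 1.-homog.
  have [Ea|ne] := eqVneq a j; last by rewrite /g override_neq // rpred0.
  by case: j / Ea v => v; rewrite /g override_eq.
have g_deg j v : mpoly_homog a j (g j v).
  have [Ea|ne] := eqVneq a j; last first.
    by rewrite /g override_neq // => m; rewrite mcoeff0 eqxx.
  case: j / Ea v => v m; rewrite /g override_eq => nz.
  have /dhomogP h := chi_homog v.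
  by rewrite (h m) ?muln1 // mcoeff_msupp.
have [_ _ univ] := free_alg M.
have [pi [pi_deg pi_incl _]] := univ P _ _ (mpoly_gca n even_a) g_deg.
have pi_word m y : word (sub_full M) m y -> pi y \is m.-homog.
  elim=> [|j v m' b _ _ IH]; first by rewrite rmorph1 dhomog1.
  by rewrite rmorphM /= pi_incl -add1n dhomogM.
have pi_pow y : Lambda_pow (sub_full M) l y -> pi y \is l.-homog.
  elim=> [|c u v /pi_word hu _ hv]; first by rewrite linear0 rpred0.
  by rewrite linearP rpredD // rpredZ.
pose phi : {linear gens M k -> P} := (pi \o (d \o iota k)).
have phi_homog v : phi v \is l.-homog by apply: pi_pow; apply: M_len; apply: memvf.
(* The image is a form of degree [l] in variables of degree [a], so a nonzero value forces
   [j.+1 = l * a]. *)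
have pi_d_other j v : j != k -> pi (d (iota j v)) = 0.
  move=> ne; apply/mpolyP => m; rewrite mcoeff0; apply/eqP/negPn/negP => nz.
  have := pi_deg _ _ (diff_deg (homog_incl v)) m nz.
  have /dhomogP h : pi (d (iota j v)) \is l.-homog by apply: pi_pow; apply: M_len; apply: memvf.
  rewrite (h m) ?mcoeff_msupp // mulnC -k_eq => -[Ekj].
  by rewrite Ekj eqxx in ne.
(* By the Leibniz rule only differentials of generators matter, and those outside degree [k] vanish
   under [pi]. *)
have pi_d b : Lambda (sub_full M) b -> form_ideal phi fullv (pi (d b)).
  have lc := gen_ideal_closed (fun _ => True) (fun s : P => exists2 u, u \in fullv & s = phi u).
  move: b; apply: Lambda_ind.
  - by apply: (@lin_closed_preim _ _ (pi \o d)).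
  - by rewrite diff1 linear0; case: lc.
  move=> j v b _ _ IH; rewrite diff_incl_mul linearD linearZ !rmorphM /=.
  apply: lin_closedD => //; last by apply: lin_closedZ => //; apply: form_ideal_mull.
  rewrite mulrC; apply: form_ideal_mull.
  have [Ejk|ne] := eqVneq j k; last by rewrite pi_d_other //; case: lc.
  case: k / Ejk in phi {phi_homog pi_d_other IH} lc *.
  by apply: gen_ideal_in => //; exists v; rewrite ?memvf.
have xE (i : 'I_n) : Lambda E (x i) by apply: Lambda_incl; apply: even_mem.
have pi_x (i : 'I_n) : pi (x i) = 'X_i.
  rewrite pi_incl /g override_eq /= /chi0 (bigD1 i) //= coord_free ?(basis_free (vbasisP _)) //.
  rewrite eqxx scale1r big1 ?addr0 // => j ne.
  by rewrite coord_free ?(basis_free (vbasisP _)) // eq_sym (negbTE ne) scale0r.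
(* Cohomology is spanned by [n0] classes, so the [n0.+1] powers of the cocycle [x i] from exponent 0
   on satisfy a relation up to a coboundary; [form_ideal_power] isolates one power from its image
   under [pi]. *)
have fq : finite_quotient phi fullv.
  move=> i; have [n0 [h [_ hcyc]]] := M_fin.
  have /fin_all_exists [c /fin_all_exists [b hb]] (N : 'I_n0.+1) : exists (c : 'I_n0 -> rat) b,
      Lambda (sub_full M) b /\ x i ^+ N = \sum_j c j *: h j + d b.
    apply: hcyc; first by apply: LambdaX; apply: Lambda_incl; apply: memvf.
    by rewrite -[_ ^+ _]mulr1 diff_even_mul // ?diff1 ?mulr0 //; apply: LambdaX.
  have [||v [[N vN] hv]] := @lin_dep _ _ _ _ (fun N : 'I_n0.+1 => x i ^+ N - d (b N)) h.
  - by move=> N; exists (c N); have [_ ->] := hb N; rewrite addrK.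
  - by rewrite !card_ord.
  exists N; apply: (@form_ideal_power _ _ _ _ phi_homog _ _ v (@nat_of_ord _) _ 1) => //.
  - by rewrite dhomogX; apply/eqP; apply: mdeg1.
  - have -> : \sum_a0 v a0 *: 'X_i ^+ a0 = pi (d (\sum_N v N *: b N)).
      have Ed : d (\sum_N v N *: b N) = \sum_N v N *: x i ^+ N.
        move: hv => /eqP; under eq_bigr do rewrite scalerBr.
        rewrite sumrB subr_eq0 => /eqP ->; rewrite linear_sum.
        by apply: eq_bigr => j _; rewrite linearZ.
      rewrite Ed linear_sum; apply: eq_bigr => j _.
      by rewrite linearZ /= rmorphXn /= pi_x.
    apply: pi_d; apply: lin_closed_sum; first exact: Lambda_lin.
    by move=> j _; apply: lin_closedZ; [exact: Lambda_lin | case: (hb j)].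
  by rewrite (big_pred1 N).
have [U dU fU] := regular_subspace l0 phi_homog fq.
exists U; split=> //.
have [E_lin E1 E_mul _] := Lambda_even_comm_sub (sub_full M).
pose sigma : P -> A := mmap (in_alg A) (fun i : 'I_n => x i).
have sigmaM : {morph sigma : p q / p * q}.
  have [] // := @commr_mmap_is_multiplicative n rat A (fun i : 'I_n => x i) (in_alg A).
  - by move=> i y; apply/esym/incl_central.
  - by move=> p m m'; rewrite /GRing.comm /= mulr_algl mulr_algr.
have sigmaP c p q : sigma (c *: p + q) = c *: sigma p + sigma q.
  by rewrite /sigma mmapD mmapZ /= mulr_algl.
have sigma0 : sigma 0 = 0 by apply: mmap0.
have sigma1 : sigma 1 = 1 by rewrite /sigma -mpolyC1 mmapC /= scale1r.
have sigmaX (i : 'I_n) : sigma 'X_i = x i by rewrite /sigma mmapX mmap1U.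
have sigmaE p : Lambda E (sigma p).
  rewrite (mpolyE p) /sigma raddf_sum; apply: lin_closed_sum => // m _ /=.
  rewrite mmapZ /= mulr_algl mmapX; apply: lin_closedZ => //.
  by apply: (big_ind (Lambda E)) => // i _; apply: LambdaX.
have gi_lin := gen_ideal_closed (Lambda E) (block_gens U).
(* A word of length [m] and degree [m * a] with a letter above degree [a] has a letter below it, so
   the last alternative does not occur in [d (iota k u)]. *)
pose small m y := Defs.homog (m * a)%N y /\ sigma (pi y) = y.
pose inI y := gen_ideal (Lambda E) (block_gens U) y /\ pi y = 0.
pose large m y := (exists D, (m * a < D)%N /\ Defs.homog D y) /\ pi y = 0.
have words m y : word E m y -> [\/ small m y, inI y | large m y].
  elim=> [|j v m' b vE wb IH].
    constructor 1; split; last by rewrite rmorph1.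
    exact: gca_one (homog_gca M).
  have lb : Lambda E b by apply: lin_span_in; exists m'.
  have [oj|ej] := boolP (odd j).
    constructor 2; rewrite (even_mem_odd oj vE) linear0 mul0r.
    by split; [case: gi_lin | rewrite linear0].
  have [lt|gt|Ej] := ltngtP j a.
  - constructor 2; split.
      rewrite incl_central //; apply: gen_ideal_mull => //; apply: gen_ideal_in => //.
      by right; exists j, v.
    by rewrite rmorphM /= pi_incl /g override_neq ?mul0r // gtn_eqF.
  - have pi0 : pi (iota j v * b) = 0.
      by rewrite rmorphM /= pi_incl /g override_neq ?mul0r // ltn_eqF.
    case: IH => [[hb _]|[hb _]|[[D [ltD hb]] _]].
    + constructor 3; split=> //; exists (j + m' * a)%N; rewrite mulSn ltn_add2r; split=> //.
      by apply: (gca_mul (homog_gca M)) => //; apply: homog_incl.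
    + by constructor 2; split=> //; apply: gen_ideal_mull => //; apply: Lambda_incl.
    + constructor 3; split=> //; exists (j + D)%N; split; first by rewrite mulSn -addSn leq_add // ltnW.
      by apply: (gca_mul (homog_gca M)) => //; apply: homog_incl.
  move: v vE {ej}; rewrite {j}Ej => v vE.
  case: IH => [[hb sb]|[hb pb]|[[D [ltD hb]] pb]].
  - constructor 1; split.
      by rewrite mulSn; apply: (gca_mul (homog_gca M)) => //; apply: homog_incl.
    rewrite rmorphM /= sigmaM sb; congr (_ * _).
    rewrite pi_incl /g override_eq /= /chi0 /sigma raddf_sum /=.
    rewrite [v in RHS](coord_vbasis (memvf v)) linear_sum; apply: eq_bigr => i _.
    by rewrite mmapZ /= mulr_algl linearZ /=; congr (_ *: _); apply: sigmaX.
  - constructor 2; split; last by rewrite rmorphM /= pb mulr0.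
    by apply: gen_ideal_mull => //; apply: Lambda_incl.
  constructor 3; split; last by rewrite rmorphM /= pb mulr0.
  exists (a + D)%N; split; first by rewrite mulSn ltn_add2l.
  by apply: (gca_mul (homog_gca M)) => //; apply: homog_incl.
(* Purity leaves words in even letters, and constant length with the degree leaves those of length
   [l] and degree [l * a]. Such a word is recovered by [sigma] after [pi], or lies in the ideal, or
   vanishes. *)
have diff_cong u : gen_ideal (Lambda E) (block_gens U) (d (iota k u) - sigma (pi (d (iota k u)))).
  have : lin_span (fun y => exists m, [/\ m = l, word E m y & Defs.homog (l * a)%N y]) (d (iota k u)).
    apply: even_words; first exact: diff_odd_incl.
    apply: lin_span_mono (homog_lin_span (homog_gca M) _ (M_len (memvf u)) (D := (l * a)%N) _).
    - by move=> y [wy hy]; exists l.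
    - by move=> y; apply: word_homog.
    by rewrite -k_eq; apply: diff_deg; apply: homog_incl.
  move: (d (iota k u)); apply: lin_span_min.
    split=> [|c p q hp hq]; first by rewrite linear0 sigma0 subr0; case: gi_lin.
    rewrite linearP sigmaP opprD addrACA -scalerBr.
    by case: gi_lin => _; apply.
  move=> y [_ [-> wy hy]].
  case: (words _ _ wy) => [[_ ->]|[Iy ->]|[[D [ltD hD]] _]].
  - by rewrite subrr; case: gi_lin.
  - by rewrite sigma0 subr0.
  have -> : y = 0; last by rewrite linear0 sigma0 subr0; case: gi_lin.
  by apply: homog_unique hD hy _; rewrite gtn_eqF.
have ideal_lift p : form_ideal phi U p -> gen_ideal (Lambda E) (block_gens U) (sigma p).
  move: p; apply: lin_span_min.
    split=> [|c p q hp hq]; first by rewrite sigma0; case: gi_lin.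
    by rewrite sigmaP; case: gi_lin => _; apply.
  move=> _ [q [_ [_ [u uU ->] ->]]]; rewrite sigmaM; apply: gen_ideal_mull => //.
  rewrite -[sigma _](subKr (d (iota k u))); apply: lin_closedB => //.
  by apply: gen_ideal_in => //; left; exists u.
move=> i; have [N hN] := fU i; exists N.
have -> : x i ^+ N = sigma ('X_i ^+ N); last exact: ideal_lift.
elim: N {hN} => [|N IH]; first by rewrite !expr0 sigma1.
by rewrite !exprS sigmaM sigmaX IH.
Qed.

End Block.

(** * Assembly of the blocks into the F_0-basis *)

Section Basis.
Variable M : freeCDGA.
Local Notation A := (alg M).
Local Notation d := (diff M).
Local Notation iota := (incl M).
Local Notation V := (sub_full M).
Local Notation E := (sub_even V).
Variable l : nat.
Hypotheses (l_ge2 : (2 <= l)%N) (M_min : minimal_sullivan V) (M_pure : pure V)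
  (M_fin : finite_dim_cohomology V) (M_len : d_maps V (Lambda_pow V l)).

(** At most one even [a] satisfies [k.+1 = l * a]; quantifying over [a] avoids division by [l]. Odd
    degrees not of this form contribute nothing. *)
Definition block_spec k (U : {vspace gens M k}) : Prop :=
  if odd k then
    (forall a, ~~ odd a -> k.+1 = (l * a)%N -> \dim U = \dim (V a) /\
       forall i : 'I_(\dim (V a)), exists N,
         gen_ideal (Lambda E) (block_gens a U) (iota a (vbasis (V a))`_i ^+ N)) /\
    ((forall a, ~~ odd a -> k.+1 <> (l * a)%N) -> U = 0%VS)
  else U = V k.

Lemma block_spec_exists k : exists U : {vspace gens M k}, block_spec U.
Proof.
rewrite /block_spec; case: (odd k) => //; last by exists (V k).
case: (classic (exists a, ~~ odd a /\ k.+1 = (l * a)%N)) => [[a [ea ka]]|no].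
  have [U [dU hU]] := block_subspace M_pure M_fin M_len ea ka.
  exists U; split=> [a' ea' ka'|h]; last by case: (h a ea ka).
  suff -> : a' = a by [].
  by apply/eqP; rewrite -(eqn_pmul2l (ltnW l_ge2)) -ka -ka'.
exists 0%VS; split=> // a ea ka; case: no; by exists a.
Qed.

Definition block_basis : graded_subspace M :=
  fun k => proj1_sig (constructive_indefinite_description _ (block_spec_exists k)).

Local Notation Z := block_basis.

Lemma block_basisP k : block_spec (Z k).
Proof. by rewrite /Z; case: constructive_indefinite_description. Qed.

Lemma block_basis_even k : ~~ odd k -> Z k = V k.
Proof. by move=> /negbTE ek; have := block_basisP k; rewrite /block_spec ek. Qed.

Lemma even_sub k : (E k <= sub_even Z k)%VS.
Proof.
by rewrite /sub_even; case: ifP => // /negbT ek; rewrite block_basis_even.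
Qed.

Lemma even_sub_basis k : (E k <= Z k)%VS.
Proof.
rewrite /sub_even; case: ifP => [_|/negbT ek]; first exact: sub0v.
by rewrite block_basis_even.
Qed.

(** Since [Z] keeps all even generators, purity sends every differential into [Lambda Z]. *)
Lemma block_basis_diff : d_maps Z (Lambda Z).
Proof.
move=> k v _; have [ok|ek] := boolP (odd k).
  by apply: (Lambda_sub even_sub_basis); apply: diff_odd_incl.
by rewrite diff_even_incl //; apply: span_zero.
Qed.

(** The primitive is required in [Lambda Z], since nilpotency is wanted in the cohomology of
    [Lambda Z] itself. *)
Definition exact_in (x : A) := exists b, Lambda Z b /\ d b = x.

Lemma exact_sub_ideal : sub_ideal (Lambda E) exact_in.
Proof.
split; first split.
- by exists 0; split; [exact: span_zero | exact: linear0].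
- move=> c x y [b [lb <-]] [b' [lb' <-]]; exists (c *: b + b'); rewrite linearP; split=> //.
  by case: (Lambda_lin Z) => _; apply.
move=> c x lc [b [lb <-]]; exists (c * b); rewrite diff_even_mul //; split=> //.
by apply: Lambda_mul => //; apply: (Lambda_sub even_sub_basis lc).
Qed.

Lemma even_nilpotent a (v : gens M a) : ~~ odd a -> radical (Lambda E) exact_in (iota a v).
Proof.
have hr := radical_lin (Lambda_even_comm_sub V) exact_sub_ideal.
(* Degree 0 is set apart because [l * 0] has no predecessor; there minimality makes [V] zero. *)
elim/ltn_ind: a v => a IH v ea; have [a0|a0] := posnP a.
  have -> : v = 0; last by rewrite linear0; case: hr.
  have [V0 _ _ _] := M_min; apply/eqP; rewrite -memv0.
  by move: v; rewrite a0 => v; rewrite -V0 memvf.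
have la0 : (0 < l * a)%N by rewrite muln_gt0 a0 ltnW.
pose k := (l * a).-1; have ka : k.+1 = (l * a)%N by rewrite prednK.
have ok : odd k by rewrite -[odd k]negbK -[~~ odd k]/(odd k.+1) ka oddM (negbTE ea) andbF.
have := block_basisP k; rewrite /block_spec ok => -[/(_ a ea ka) [_ hU] _].
rewrite (coord_vbasis (memvf v)) linear_sum; apply: lin_closed_sum => // i _.
rewrite linearZ; apply: lin_closedZ => //.
have [N hN] := hU i.
apply: (@radical_root _ _ _ _ N); first by apply: Lambda_incl; apply: even_mem.
apply: (gen_ideal_radical (Lambda_even_comm_sub V) exact_sub_ideal) hN.
move=> s [[u uZ ->]|[b [w [ltb eb ->]]]]; last exact: IH.
apply: radical_in; first exact: diff_odd_incl.
by exists (iota k u); split=> //; apply: Lambda_incl.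
Qed.

(** The bound [l * N0] exceeds [l * a - 1] for all [a < N0], so the sums in the homotopy
    characteristic reach every block. *)
Lemma block_basis_vanishes N0 : vanishes_from V N0 -> vanishes_from Z (l * N0).
Proof.
move=> V0 k le; have := block_basisP k; rewrite /block_spec; case: ifP => ok; last first.
  by move=> ->; apply: V0; apply: leq_trans le; rewrite leq_pmull // ltnW.
case: (classic (exists a, ~~ odd a /\ k.+1 = (l * a)%N)) => [[a [ea ka]]|no] [h1 h2].
  have [dU _] := h1 a ea ka; apply/eqP; rewrite -dimv_eq0 dU dimv_eq0; apply/eqP.
  by apply: V0; rewrite ltnW // -(ltn_pmul2l (ltnW l_ge2)) -ka.
by apply: h2 => a ea ka; apply: no; exists a.
Qed.

Lemma block_basis_elliptic N0 : vanishes_from V N0 -> elliptic Z.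
Proof.
move=> V0; split; first by exists (l * N0)%N; apply: block_basis_vanishes.
apply: (finite_cohomology (block_basis_vanishes V0) block_basis_diff).
  by move=> k v ek _; apply: diff_even_incl.
by move=> k v ek _; have [_] := even_nilpotent v ek.
Qed.

(** The block of [V a] contributes equal dimensions in the even degree [a] and the odd degree
    [l * a - 1]. *)
Lemma block_basis_homotopy_char N0 : vanishes_from V N0 -> has_homotopy_char Z 0.
Proof.
move=> V0; pose N := (l * N0)%N; exists N; first exact: block_basis_vanishes.
pose D a := \dim (V a).
have l0 : (0 < l)%N := ltnW l_ge2.
have V00 : D 0%N = 0%N by have [V0' _ _ _] := M_min; rewrite /D V0' dimv0.
have D0 a : (N0 <= a)%N -> D a = 0%N by move=> /V0; rewrite /D => ->; apply: dimv0.
suff -> : (\sum_(k < N | odd k) \dim (Z k) = \sum_(k < N | ~~ odd k) \dim (Z k))%N by rewrite subrr.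
(* The sum has at most one term; this form lets the order of summation over [k] and [a] be
   exchanged. *)
have odd_dim (k : 'I_N) : odd k ->
    \dim (Z k) = (\sum_(a < N | ~~ odd a && (k.+1 == l * a)) D a)%N.
  move=> ok; have := block_basisP k; rewrite /block_spec ok => -[h1 h2].
  case: (classic (exists a, ~~ odd a /\ k.+1 = (l * a)%N)) => [[a [ea ka]]|no].
    have [-> _] := h1 a ea ka.
    have lt : (a < N)%N.
      have : (l * a <= l * N0)%N by rewrite -ka.
      rewrite leq_pmul2l // => /leq_ltn_trans; apply.
      have N00 : (0 < N0)%N.
        by have := leq_ltn_trans (leq0n k) (ltn_ord k); rewrite muln_gt0 => /andP [].
      by rewrite ltn_Pmull.
    rewrite (big_pred1 (Ordinal lt)) // => b /=.
    rewrite ka eqn_pmul2l // -val_eqE /= eq_sym andbC; case: eqP => // ->.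
    by rewrite ea.
  rewrite h2 ?dimv0 => [|a ea ka]; last by apply: no; exists a.
  by rewrite big1 // => a /andP [ea /eqP ka]; case: no; exists a.
rewrite (eq_bigr _ odd_dim) (exchange_big_dep (fun a : 'I_N => ~~ odd a)) /=; last first.
  by move=> k a _ /andP [].
apply: eq_bigr => a ea; rewrite block_basis_even // -/(D a).
have [Da|Da] := eqVneq (D a) 0%N; first by rewrite Da big1.
(* For [a = 0] the partner degree would be a truncated predecessor; this case is excluded as [V 0]
   is zero. *)
have a0 : (0 < a)%N by rewrite lt0n; apply: contraNneq Da => ->; rewrite V00.
have aN : (a < N0)%N by rewrite ltnNge; apply: contraNN Da => /D0 ->.
have la0 : (0 < l * a)%N by rewrite muln_gt0 l0.
have lt : ((l * a).-1 < N)%N by rewrite prednK // /N leq_pmul2l // ltnW.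
rewrite (big_pred1 (Ordinal lt)) // => k /=; rewrite ea /= -val_eqE /=.
have -> : (k == (l * a).-1 :> nat) = (k.+1 == l * a)%N by rewrite -eqSS prednK.
rewrite andbC; case: eqP => // ka.
by have := congr1 odd ka; rewrite /= oddM (negbTE ea) andbF => /negbFE.
Qed.

(** Words of length at least 2 in [V] must be replaced by words in [Z]; [even_words] does this
    without changing their length. *)
Lemma block_basis_minimal : minimal_sullivan Z.
Proof.
have [V0 V1 _ V_ge2] := M_min.
have sub0 k : V k = 0%VS -> Z k = 0%VS.
  by move=> Vk; apply/eqP; rewrite -subv0 -Vk; apply: subvf.
split; [exact: sub0 | exact: sub0 | | ]; last first.
  move=> k v _; have [ok|ek] := boolP (odd k); last first.
    by rewrite diff_even_incl //; apply: span_zero.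
  have : lin_span (fun x => exists m, [/\ (2 <= m)%N, word E m x & True]) (d (iota k v)).
    apply: even_words; first exact: diff_odd_incl.
    by apply: lin_span_mono (V_ge2 k v (memvf v)) => x [m le wx]; exists m.
  apply: lin_span_mono => x [m [le wx _]]; exists m => //.
  exact: word_sub even_sub_basis wx.
split; first by move=> k v; rewrite memv0 => /eqP ->; rewrite !linear0; apply: span_zero.
(* Purity gives a two-step filtration: the even generators are cocycles, and odd differentials
   involve only these. *)
exists Z, (fun p => if p is 0 then sub_even Z else Z); split.
- by move=> k; rewrite /sub_zero add0v cap0v.
- move=> [|p] k; last by [].
  by rewrite /sub_even; case: ifP => _; rewrite ?sub0v ?subvv.
- by move=> k v vZ; exists 1%N.
- move=> k v; rewrite /sub_even; case: ifP => [_|/negbT ek _].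
    by rewrite memv0 => /eqP ->; rewrite !linear0; apply: span_zero.
  by rewrite diff_even_incl //; apply: span_zero.
move=> p k v _; have [ok|ek] := boolP (odd k); last first.
  by rewrite diff_even_incl //; apply: span_zero.
apply: Lambda_sub (diff_odd_incl M_pure v ok) => j.
rewrite /sub_add /sub_zero add0v; case: p => [|p]; [exact: even_sub | exact: even_sub_basis].
Qed.

Lemma block_basis_pure : pure Z.
Proof.
move=> k v _; case: ifP => [ok|/negbT ek]; last exact: diff_even_incl.
by apply: (Lambda_sub even_sub); apply: diff_odd_incl.
Qed.

(** Every generator has its differential in [Lambda Z], so any complement of [Z] serves, with a
    constant filtration. *)
Lemma block_basis_relative : relative_sullivan Z V.
Proof.
split; first exact: block_basis_diff.
have diffZ k (v : gens M k) : Lambda Z (d (iota k v)).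
  have [ok|ek] := boolP (odd k); last by rewrite diff_even_incl //; apply: span_zero.
  by apply: (Lambda_sub even_sub_basis); apply: diff_odd_incl.
exists (fun k => (Z k)^C%VS), (fun _ k => (Z k)^C%VS); split.
- by move=> k; rewrite addv_complf capv_compl.
- by [].
- by move=> k v vW; exists 0%N.
- by move=> k v _.
by move=> p k v _; apply: Lambda_sub (diffZ k v) => j; apply: addvSl.
Qed.

End Basis.

Theorem theorem2 (M : freeCDGA)
    (hmin : minimal_sullivan (sub_full M)) (hpure : pure (sub_full M))
    (hell : elliptic (sub_full M)) (hlen : constant_length (sub_full M)) :
  exists Z : graded_subspace M,
    F0_basis_extension Z /\
    (forall k : nat, ~~ odd k -> Z k = sub_full M k).
Proof.
have [[N0 V0] hfin] := hell; have [l l2 hl] := hlen.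
exists (block_basis l2 hpure hfin hl); split; last exact: block_basis_even.
split; first exact: block_basis_relative.
split; [exact: block_basis_minimal | exact: block_basis_pure | |].
  exact: block_basis_elliptic V0.
exact: block_basis_homotopy_char V0.
Qed.
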